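(* Let $\Lambda$ be an Auslander algebra (finite dimensional over an algebraically closed field $k$). Then there exists a tilting $\Lambda$-module with the hereditary property.
   Context: All algebras are finite dimensional over an algebraically closed field $k$; $\operatorname{mod}\Lambda$ is the category of finitely generated right $\Lambda$-modules; $\operatorname{pd}_\Lambda M$ is the projective dimension of $M$; $\operatorname{add}T$ is the full subcategory of $\operatorname{mod}\Lambda$ whose objects are the direct sums of direct summands of $T$; $\operatorname{Gen}T$ is the class of all $X\in\operatorname{mod}\Lambda$ for which there exist an integer $d\ge 0$ and an epimorphism $T^d\to X$. Auslander algebra: if $B$ is an algebra of finite representation type and $M_1,\dots,M_n$ is a complete set of representatives of the isomorphism classes of indecomposable $B$-modules, then $\operatorname{End}_B(\bigoplus_{i=1}^n M_i)$ is the Auslander algebra of $B$. An algebra is called an Auslander algebra if it arises in this way, up to Morita equivalence; by Auslander's characterization these are exactly the algebras $\Lambda$ with global dimension at most $2$ and dominant dimension at least $2$. Here, if $0\to\Lambda_\Lambda\to I_0\to I_1\to I_2\to\cdots$ is a minimal injective resolution, the dominant dimension of $\Lambda$ is $n$ if $I_i$ is projective for $0\le i\le n-1$ and $I_n$ is not projective, and is $\infty$ if all $I_n$ are projective. Tilting module: a $\Lambda$-module $T\in\operatorname{mod}\Lambda$ such that (1) $\operatorname{pd}_\Lambda T\le 1$; (2) $\operatorname{Ext}^1_\Lambda(T,T)=0$; (3) there exists a short exact sequence $0\to\Lambda_\Lambda\to T'\to T''\to 0$ in $\operatorname{mod}\Lambda$ with $T',T''\in\operatorname{add}T$. Hereditary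 property: a tilting $\Lambda$-module $T$ possesses the hereditary property if, for every module $M\in\operatorname{Gen}T$, there exists a short exact sequence $0\to T'\to T''\to M\to 0$ in $\operatorname{mod}\Lambda$ with $T',T''\in\operatorname{add}T$. *)

(* Defs.v *)
From HB Require Import structures.
From mathcomp Require Import all_boot all_algebra all_field.

Set Implicit Arguments.
Unset Strict Implicit.
Unset Printing Implicit Defensive.

Import GRing.Theory.
Local Open Scope ring_scope.

(* MathComp only equips non-dependent finite functions with a module
   structure; [{dffun forall i, V i}] is the direct sum of a finite family. *)
Section FiniteDirectSum.
Context (R : nzRingType) (I : finType) (V : I -> lmodType R).
Local Notation dsum := {dffun forall i, V i}.
Implicit Types (f g h : dsum).

Definition dsum_zero : dsum := [ffun i => 0 : V i].
Definition dsum_opp f : dsum := [ffun i => - f i : V i].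
Definition dsum_add f g : dsum := [ffun i => f i + g i : V i].
Definition dsum_scale (a : R) f : dsum := [ffun i => a *: f i : V i].

Fact dsum_addA : associative dsum_add.
Proof. by move=> f g h; apply/ffunP => i; rewrite !ffunE addrA. Qed.
Fact dsum_addC : commutative dsum_add.
Proof. by move=> f g; apply/ffunP => i; rewrite !ffunE addrC. Qed.
Fact dsum_add0 : left_id dsum_zero dsum_add.
Proof. by move=> f; apply/ffunP => i; rewrite !ffunE add0r. Qed.
Fact dsum_addN : left_inverse dsum_zero dsum_opp dsum_add.
Proof. by move=> f; apply/ffunP => i; rewrite !ffunE addNr. Qed.

HB.instance Definition _ :=
  GRing.isZmodule.Build dsum dsum_addA dsum_addC dsum_add0 dsum_addN.

Fact dsum_scaleA a b f : dsum_scale a (dsum_scale b f) = dsum_scale (a * b) f.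
Proof. by apply/ffunP => i; rewrite !ffunE scalerA. Qed.
Fact dsum_scale1 : left_id 1 dsum_scale.
Proof. by move=> f; apply/ffunP => i; rewrite !ffunE scale1r. Qed.
Fact dsum_scaleDr : right_distributive dsum_scale +%R.
Proof. by move=> a f g; apply/ffunP => i; rewrite !ffunE scalerDr. Qed.
Fact dsum_scaleDl f : {morph dsum_scale^~ f : a b / a + b}.
Proof. by move=> a b; apply/ffunP => i; rewrite !ffunE scalerDl. Qed.

HB.instance Definition _ :=
  GRing.Zmodule_isLmodule.Build R dsum
    dsum_scaleA dsum_scale1 dsum_scaleDr dsum_scaleDl.

End FiniteDirectSum.

Definition surjective (X Y : Type) (f : X -> Y) : Prop :=
  forall y, exists x, f x = y.

Definition iso (R : nzRingType) (M N : lmodType R) : Prop :=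
  exists f : {linear M -> N}, bijective f.

Definition short_exact (R : nzRingType) (L M N : lmodType R)
    (f : {linear L -> M}) (g : {linear M -> N}) : Prop :=
  [/\ injective f,
      forall y, g y = 0 <-> exists x, f x = y
    & surjective g].

Definition finitely_generated (R : nzRingType) (M : lmodType R) : Prop :=
  exists (n : nat) (e : 'I_n -> M),
    forall x, exists c : 'I_n -> R, x = \sum_(i < n) c i *: e i.

(* mod A. Right A-modules are left modules over the converse ring: for
   [M : lmodType A^c], x . a is [a *: x]. The right regular module A_A is
   [A^c^o]. *)
Record fgmod (k : fieldType) (A : falgType k) := FgMod {
  fgmod_sort :> lmodType A^c;
  fgmodP : finitely_generated fgmod_sort
}.

(* The k-vector space structure of a right A-module. *)
Definition kscale (k : fieldType) (A : falgType k) (M : lmodType A^c)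
    (c : k) (x : M) : M := ((c%:A : A) : A^c) *: x.

Definition indecomposable (k : fieldType) (A : falgType k) (M : fgmod A) :
    Prop :=
  (exists x : M, x != 0) /\
  forall X Y : fgmod A, iso M (X * Y)%type ->
    (forall x : X, x = 0) \/ (forall y : Y, y = 0).

Definition is_summand (k : fieldType) (A : falgType k) (X T : fgmod A) :
    Prop :=
  exists Y : fgmod A, iso T (X * Y)%type.

Definition in_add (k : fieldType) (A : falgType k) (T X : fgmod A) : Prop :=
  exists (d : nat) (S : 'I_d -> fgmod A),
    (forall i, is_summand (S i) T) /\ iso X {dffun forall i, S i}.

Definition in_Gen (k : fieldType) (A : falgType k) (T X : fgmod A) : Prop :=
  exists (d : nat) (g : {linear {ffun 'I_d -> T} -> X}), surjective g.

Definition projective (k : fieldType) (A : falgType k) (P : fgmod A) : Prop :=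
  forall (M N : fgmod A) (g : {linear M -> N}) (f : {linear P -> N}),
    surjective g -> exists h : {linear P -> M}, forall x, g (h x) = f x.

(* A projective resolution 0 -> P_n -> ... -> P_0 -> M -> 0, cut into short
   exact sequences. *)
Fixpoint pd_le (k : fieldType) (A : falgType k) (n : nat) (M : fgmod A) :
    Prop :=
  if n is m.+1 then
    exists (K P : fgmod A) (f : {linear K -> P}) (g : {linear P -> M}),
      [/\ projective P, short_exact f g & pd_le m K]
  else projective M.

(* Ext^1_A(X, Y) = 0 for Yoneda's Ext^1, the group of classes of extensions
   0 -> Y -> E -> X -> 0: its zero element is the class of split extensions. *)
Definition Ext1_eq0 (k : fieldType) (A : falgType k) (X Y : fgmod A) : Prop :=
  forall (E : fgmod A) (f : {linear Y -> E}) (g : {linear E -> X}),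
    short_exact f g -> exists s : {linear X -> E}, forall x, g (s x) = x.

Definition tilting (k : fieldType) (A : falgType k) (T : fgmod A) : Prop :=
  [/\ pd_le 1 T,
      Ext1_eq0 T T
    & exists (T' T'' : fgmod A)
             (f : {linear A^c^o -> T'}) (g : {linear T' -> T''}),
        [/\ in_add T T', in_add T T'' & short_exact f g]].

Definition hereditary_property (k : fieldType) (A : falgType k)
    (T : fgmod A) : Prop :=
  forall M : fgmod A, in_Gen T M ->
    exists (T' T'' : fgmod A) (f : {linear T' -> T''}) (g : {linear T'' -> M}),
      [/\ in_add T T', in_add T T'' & short_exact f g].

(* Equalities of morphisms are stated pointwise. [fmap_lin] is k-linearity of
   [fmap], and with c = 0 it also says that [fmap] respects pointwise
   equality. *)
Record linear_functor (k : fieldType) (A B : falgType k) := LinearFunctor {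
  fobj :> fgmod A -> fgmod B;
  fmap : forall X Y : fgmod A, {linear X -> Y} -> {linear fobj X -> fobj Y};
  fmap_id : forall (X : fgmod A) (f : {linear X -> X}),
    f =1 id -> fmap f =1 id;
  fmap_comp : forall (X Y Z : fgmod A) (f : {linear X -> Y})
    (g : {linear Y -> Z}) (h : {linear X -> Z}),
    h =1 g \o f -> fmap h =1 fmap g \o fmap f;
  fmap_lin : forall (X Y : fgmod A) (c : k) (f g h : {linear X -> Y}),
    (forall x, h x = kscale c (f x) + g x) ->
    forall y, fmap h y = kscale c (fmap f y) + fmap g y
}.

(* The composite [G \o F] is naturally isomorphic to the identity of mod A. *)
Definition left_quasi_inverse (k : fieldType) (A B : falgType k)
    (F : linear_functor A B) (G : linear_functor B A) : Prop :=
  exists eta : forall X : fgmod A, {linear X -> G (F X)},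
    (forall X, bijective (eta X)) /\
    (forall (X Y : fgmod A) (f : {linear X -> Y}) (x : X),
       eta Y (f x) = fmap G (fmap F f) (eta X x)).

Definition Morita_equivalent (k : fieldType) (A B : falgType k) : Prop :=
  exists (F : linear_functor A B) (G : linear_functor B A),
    left_quasi_inverse F G /\ left_quasi_inverse G F.

(* E is isomorphic, as a k-algebra, to End_A(M) with product (u v)(x) = u (v x). *)
Definition is_End_algebra (k : fieldType) (A : falgType k) (M : lmodType A^c)
    (E : falgType k) : Prop :=
  exists phi : E -> {linear M -> M},
    [/\ phi 1 =1 id,
        forall u v, phi (u * v) =1 phi u \o phi v,
        forall (c : k) u v x, phi (c *: u + v) x = kscale c (phi u x) + phi v x,
        forall u v, phi u =1 phi v -> u = v
      & forall f : {linear M -> M}, exists u, phi u =1 f].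

(* That such a finite family M exists says that B has finite representation
   type. *)
Definition complete_indecomposables (k : fieldType) (B : falgType k) (n : nat)
    (M : 'I_n -> fgmod B) : Prop :=
  [/\ forall i, indecomposable (M i),
      forall i j, iso (M i) (M j) -> i = j
    & forall X : fgmod B, indecomposable X -> exists i, iso X (M i)].

Definition Auslander_algebra (k : fieldType) (A : falgType k) : Prop :=
  exists (B : falgType k) (n : nat) (M : 'I_n -> fgmod B) (E : falgType k),
    [/\ complete_indecomposables M,
        is_End_algebra {dffun forall i, M i} E
      & Morita_equivalent A E].

(* Main.v *)
From HB Require Import structures.
Require Import Defs.
From mathcomp Require Import all_boot all_algebra all_field.
From mathcomp Require Import boolp.

(** Only two properties of an Auslander algebra are used: every f.g. projective
module embeds in a f.g. module that is both projective and injective (dominant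
dimension at least 1), and the kernel of a map between projectives is projective
(global dimension at most 2).

The tilting module. Let j : A -> Q be an embedding into a projective-injective
module, C = Q / j A and T = Q + C. The sequence 0 -> A -> Q -> C -> 0 gives pd T
<= 1 and the coresolution of A by add T. The key remark is that Ext^1 vanishes
between modules X of projective dimension at most 1 and modules Y generated by Q
([Ext1_generated]): for 0 -> P1 -> P0 -> X -> 0, a map P1 -> Y lifts to a power
of Q because P1 is projective, then extends to P0 because Q is injective. As T
is generated by Q, it has no self-extension.

The hereditary property. A module of Gen T is generated by Q. If it is the
quotient of Q^a by the image of A^m, the pushout of the inclusion A^m -> Q^m
along A^m -> Q^a is N = Q^a + C^m, and it maps onto the given module with a
kernel K that is again generated by Q ([approximation]). The bound on the global
dimension gives pd K <= 1 ([pd_le1_sub]). The same construction for K gives an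
epimorphism N' -> K from a module in add T with kernel generated by Q, and the
key remark says that it splits: K is a direct summand of a power of T. A direct
summand of a power of T is a direct sum of direct summands of T by the
Krull-Schmidt argument, with Fitting's lemma ([retract_in_add]); so K -> N is
the kernel part of the required sequence.

The two properties hold for E = End_B(M), where M is the sum of the
indecomposable B-modules, so that every f.g. B-module is a direct summand of a
power of M ([retract_generator]). The dual DM = Hom_k(M, k) is a right E-module;
it is projective because DM = Hom_B(M, DB) and DB is a summand of a power of M
([end_dual_retract]); it is injective because B is a summand of a power of M,
which makes M a projective left E-module ([end_dual_injective]); and E acts
faithfully on M, so that E embeds in a power of DM ([end_embeds]). A map between
free E-modules is a matrix of endomorphisms of M; its kernel is Hom_B(M, N),
where N is the kernel of that matrix on a power of M, and N is a summand of a
power of M ([end_kernel_retract]). Both properties only speak of monomorphisms,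
epimorphisms and kernels, so that they pass to every Morita equivalent algebra
([Morita_embedding], [Morita_kernels]). *)

Set Implicit Arguments.
Unset Strict Implicit.
Unset Printing Implicit Defensive.

Import GRing.Theory.
Local Open Scope ring_scope.

(** * Linear maps, submodules and quotient modules *)

Section LinearMaps.
Context (R : nzRingType).

Definition lin (U V : lmodType R) (f : U -> V) (fl : linear f) :
  {linear U -> V} := HB.pack f (GRing.isLinear.Build R U V _ f fl).

Lemma kernel_injective (U V : lmodType R) (f : {linear U -> V}) :
  (forall x, f x = 0 -> x = 0) -> injective f.
Proof.
by move=> f0 x y fxy; apply/subr0_eq/f0; rewrite linearB /= fxy subrr.
Qed.

Lemma linear_inverse (U V : lmodType R) (f : {linear U -> V}) :
  bijective f -> exists g : {linear V -> U}, cancel f g /\ cancel g f.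
Proof.
case=> g fK gK; have gl : linear g.
  by move=> a x y; apply: (can_inj fK); rewrite linearP !gK.
by exists (lin gl).
Qed.

Lemma factor_surjective (U V W : lmodType R) (g : {linear U -> V})
    (f : {linear U -> W}) :
  surjective g -> (forall x, g x = 0 -> f x = 0) ->
  exists h : {linear V -> W}, forall x, h (g x) = f x.
Proof.
move=> /choice[s gs] kfg.
have fs x y : g x = g y -> f x = f y.
  move=> gxy; apply/subr0_eq; rewrite -linearB; apply: kfg.
  by rewrite linearB /= gxy subrr.
have hl : linear (fun y => f (s y)).
  by move=> a x y; rewrite -linearP; apply: fs; rewrite linearP !gs.
by exists (lin hl) => x /=; apply: fs; rewrite gs.
Qed.

Lemma factor_injective (U V W : lmodType R) (i : {linear V -> U})
    (f : {linear W -> U}) :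
  injective i -> (forall x, exists y, i y = f x) ->
  exists h : {linear W -> V}, forall x, i (h x) = f x.
Proof.
move=> ii /choice[h ih].
have hl : linear h by move=> a x y; apply: ii; rewrite linearP !ih linearP.
by exists (lin hl).
Qed.

Lemma iso_sym (U V : lmodType R) : iso U V -> iso V U.
Proof. by case=> f /linear_inverse[g [fK gK]]; exists g; exists f. Qed.

End LinearMaps.

Section Submodules.
Context (R : nzRingType) (V : lmodType R).

(** The closure proofs are bundled with the predicate so that the module
structures of the submodule and of the quotient can be inferred from it. *)
Record submodule := Submodule {
  smem :> V -> Prop;
  smem0 : smem 0;
  smemP : forall a x y, smem x -> smem y -> smem (a *: x + y)
}.

Implicit Types S : submodule.

Definition spred (S : submodule) : {pred V} := fun x => `[< S x >].

Lemma spredP S x : reflect (S x) (x \in spred S).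
Proof. exact: asboolP. Qed.

Fact spred_closed S : submod_closed (spred S).
Proof.
split; first by apply/spredP/smem0.
by move=> a x y /spredP Sx /spredP Sy; apply/spredP/smemP.
Qed.

HB.instance Definition _ S :=
  GRing.isSubmodClosed.Build R V (spred S)
    (spred_closed S).

Record subm (S : submodule) := Subm { subm_val :> V; _ : subm_val \in spred S }.

HB.instance Definition _ S := [isSub for @subm_val S].
HB.instance Definition _ S := [Choice of subm S by <:].
HB.instance Definition _ S := [SubChoice_isSubLmodule of subm S by <:].

Definition sub_incl S : {linear subm S -> V} := \val.

Lemma sub_incl_inj S : injective (sub_incl S).
Proof. exact: val_inj. Qed.

Lemma sub_inclP S x : S x <-> exists y, sub_incl S y = x.
Proof.
split=> [Sx | [y <-]]; last by apply/spredP/(valP y).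
by exists (Subm (introT (spredP S x) Sx)).
Qed.

End Submodules.

Section KernelImage.
Context (R : nzRingType) (U V : lmodType R) (f : {linear U -> V}).

Fact ker_closed a x y : f x = 0 -> f y = 0 -> f (a *: x + y) = 0.
Proof. by move=> fx fy; rewrite linearP fx fy scaler0 addr0. Qed.
Definition kersub := Submodule (linear0 f) ker_closed.

Fact im_closed a x y : (exists z, f z = x) -> (exists z, f z = y) ->
  exists z, f z = a *: x + y.
Proof. by case=> u <- [v <-]; exists (a *: u + v); rewrite linearP. Qed.
Definition imsub := Submodule (ex_intro _ 0 (linear0 f)) im_closed.
End KernelImage.

Section Quotient.
Context (R : nzRingType) (V : lmodType R) (S : submodule V).

(** [choose] depends only on the coset of x, so this picks one representative
per coset; the quotient module is carried by the chosen representatives. *)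
Definition qrepr (x : V) : V := choose (fun y => `[< S (y - x) >]) x.

Lemma smemN x : S x -> S (- x).
Proof. by move=> Sx; rewrite -scaleN1r -[_ *: _]addr0; apply/smemP/smem0. Qed.
Lemma smemD x y : S x -> S y -> S (x + y).
Proof. by move=> Sx Sy; rewrite -[x]scale1r; apply: smemP. Qed.
Lemma smemZ a x : S x -> S (a *: x).
Proof. by move=> Sx; rewrite -[_ *: _]addr0; apply/smemP/smem0. Qed.

Lemma qreprP x : S (qrepr x - x).
Proof.
apply/asboolP; apply: (@chooseP _ (fun y => `[< S (y - x) >])).
by rewrite subrr; apply/asboolP/smem0.
Qed.

Lemma qrepr_eq x y : S (x - y) <-> qrepr x = qrepr y.
Proof.
split=> [Sxy | exy].
  rewrite /qrepr (@eq_choose _ _ (fun z => `[< S (z - y) >])).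
    apply: choose_id; last by rewrite subrr; apply/asboolP/smem0.
    exact/asboolP.
  move=> z; apply/asboolP/asboolP => Sz.
    by rewrite -(subrKA x); apply: smemD.
  by rewrite -[x]opprK -(subrKA (y)) opprK; apply: smemD => //;
     rewrite -opprB; apply: smemN.
rewrite -(subrKA (qrepr x)) -opprB {2}exy.
by apply: smemD; [apply: smemN|]; apply: qreprP.
Qed.

Record quot := Quot { quot_val : V; _ : qrepr quot_val == quot_val }.
HB.instance Definition _ := [isSub for quot_val].
HB.instance Definition _ := [Choice of quot by <:].

Fact qrepr_idem x : qrepr (qrepr x) == qrepr x.
Proof. by apply/eqP; apply/(qrepr_eq _ x).1; apply: qreprP. Qed.

Definition quot_class x : quot := Quot (qrepr_idem x).

Lemma quot_class_eq x y : quot_class x = quot_class y <-> S (x - y).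
Proof.
split=> [[] /(qrepr_eq x y).2 // | /(qrepr_eq x y).1 exy]; exact/val_inj.
Qed.

Lemma quot_valK : cancel quot_val quot_class.
Proof. by move=> y; apply: val_inj; case: y => x /= /eqP. Qed.

Definition quot_add x y := quot_class (quot_val x + quot_val y).
Definition quot_opp x := quot_class (- quot_val x).
Definition quot_scale a x := quot_class (a *: quot_val x).

Lemma quot_addE x y :
  quot_add (quot_class x) (quot_class y) = quot_class (x + y).
Proof.
apply/quot_class_eq; rewrite opprD addrACA.
by apply: smemD; apply: qreprP.
Qed.
Lemma quot_oppE x : quot_opp (quot_class x) = quot_class (- x).
Proof. by apply/quot_class_eq; rewrite -opprD; apply/smemN/qreprP. Qed.
Lemma quot_scaleE a x : quot_scale a (quot_class x) = quot_class (a *: x).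
Proof. by apply/quot_class_eq; rewrite -scalerBr; apply/smemZ/qreprP. Qed.

Fact quot_addA : associative quot_add.
Proof.
move=> x y z; rewrite -[x]quot_valK -[y]quot_valK -[z]quot_valK.
by rewrite !quot_addE addrA.
Qed.
Fact quot_addC : commutative quot_add.
Proof. by move=> x y; rewrite /quot_add addrC. Qed.
Fact quot_add0 : left_id (quot_class 0) quot_add.
Proof. by move=> x; rewrite -[x]quot_valK quot_addE add0r. Qed.
Fact quot_addN : left_inverse (quot_class 0) quot_opp quot_add.
Proof. by move=> x; rewrite -[x]quot_valK quot_oppE quot_addE addNr. Qed.

HB.instance Definition _ :=
  GRing.isZmodule.Build quot quot_addA quot_addC quot_add0 quot_addN.

Fact quot_scaleA a b x : quot_scale a (quot_scale b x) = quot_scale (a * b) x.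
Proof. by rewrite -[x]quot_valK !quot_scaleE scalerA. Qed.
Fact quot_scale1 : left_id 1 quot_scale.
Proof. by move=> x; rewrite -[x]quot_valK quot_scaleE scale1r. Qed.
Fact quot_scaleDr : right_distributive quot_scale +%R.
Proof.
move=> a x y; rewrite -[x]quot_valK -[y]quot_valK [_ + _]quot_addE !quot_scaleE.
by rewrite [RHS]quot_addE scalerDr.
Qed.
Fact quot_scaleDl x : {morph quot_scale^~ x : a b / a + b}.
Proof.
move=> a b; rewrite -[x]quot_valK !quot_scaleE [RHS]quot_addE.
by rewrite scalerDl.
Qed.

HB.instance Definition _ :=
  GRing.Zmodule_isLmodule.Build R quot
    quot_scaleA quot_scale1 quot_scaleDr quot_scaleDl.

Fact quot_class_linear : linear quot_class.
Proof.
by move=> a x y; rewrite -[RHS]/(quot_add (quot_scale _ _) _) quot_scaleE quot_addE.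
Qed.
Definition quot_proj : {linear V -> quot} := lin quot_class_linear.

Lemma quot_proj_surj : surjective quot_proj.
Proof. by move=> y; exists (quot_val y); apply: quot_valK. Qed.

Lemma quot_proj_eq0 x : quot_proj x = 0 <-> S x.
Proof. by rewrite -{2}(subr0 x); split=> /quot_class_eq. Qed.

End Quotient.

(** * Finite dimension over the base field *)

Section FiniteDimension.
Context (k : fieldType).

Lemma finitely_generatedI (R : nzRingType) (M : lmodType R) (I : finType)
    (e : I -> M) :
  (forall x, exists c : I -> R, x = \sum_i c i *: e i) ->
  finitely_generated M.
Proof.
move=> sp; exists #|I|, (e \o enum_val) => x; have [c ->] := sp x.
by exists (c \o enum_val); rewrite (reindex _ (onW_bij _ (enum_val_bij I))).
Qed.

(** A spanning family of minimal size is a basis: a nontrivial relation would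
express one vector by the others. *)
Lemma finite_basis (V : lmodType k) : finitely_generated V ->
  exists m (f : {linear 'rV[k]_m -> V}), bijective f.
Proof.
move=> fgV; pose p n := `[< exists e : 'I_n -> V,
    forall x, exists c : 'I_n -> k, x = \sum_(i < n) c i *: e i >].
have exp : exists n, p n.
  by case: fgV => n [e sp]; exists n; apply/asboolP; exists e.
have [n /asboolP[e sp] minn_] := ex_minnP exp.
have fl : linear (fun c : 'rV[k]_n => \sum_i c 0 i *: e i).
  move=> a c d; rewrite scaler_sumr -big_split /=; apply: eq_bigr => i _.
  by rewrite !mxE scalerDl scalerA.
exists n, (lin fl) => /=.
suff fi : injective (lin fl).
  have fs : surjective (lin fl).
    move=> y; have [c ->] := sp y; exists (\row_i c i) => /=.
    by apply: eq_bigr => i _; rewrite mxE.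
  by have /choice[g gK] := fs; exists g => // c; apply: fi; rewrite gK.
apply: kernel_injective => c /= c0; apply: contrapT => /eqP/rV0Pn[j cj0].
case: n j => [[] //|n] j in e sp minn_ fl c c0 cj0 *.
suff /minn_ : p n by rewrite ltnn.
apply/asboolP; exists (e \o lift j) => x; have [d ->] := sp x.
(* subtract the multiple of the relation c that cancels the coefficient d j *)
exists (fun i => d (lift j i) - d j / c 0 j * c 0 (lift j i)).
transitivity (\sum_i (d i - d j / c 0 j * c 0 i) *: e i).
  have -> : \sum_i d i *: e i =
            \sum_i d i *: e i - (d j / c 0 j) *: \sum_i c 0 i *: e i.
    by rewrite c0 scaler0 subr0.
  rewrite scaler_sumr -sumrB.
  by apply: eq_bigr => i _; rewrite scalerBl scalerA.
by rewrite (bigD1_ord j) //= divfK // subrr scale0r add0r.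
Qed.

(** A family in P whose span has maximal dimension spans P. *)
Lemma span_pred (V : vectType k) (P : V -> Prop) :
  exists s : seq V,
    (forall x, x \in s -> P x) /\ forall x, P x -> x \in <<s>>%VS.
Proof.
pose p n := `[< exists s : seq V,
    (forall x, x \in s -> P x) /\ \dim <<s>>%VS = n >].
have exp : exists n, p n.
  by exists (\dim <<[::] : seq V>>%VS); apply/asboolP; exists [::].
have ub n : p n -> (n <= \dim {: V})%N.
  by move=> /asboolP[s [_ <-]]; apply/dimvS/subvf.
have [n /asboolP[s [Ps dims]] maxn_] := ex_maxnP exp ub.
exists s; split=> // x Px.
have sub : (<<s>> <= <<x :: s>>)%VS.
  by apply: sub_span => y ys; rewrite inE ys orbT.
suff /eqP-> : <<s>>%VS == <<x :: s>>%VS by apply: memv_span; rewrite mem_head.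
rewrite eqEdim sub dims; apply: maxn_; apply/asboolP; exists (x :: s).
by split=> // y; rewrite inE => /orP[/eqP-> //|/Ps].
Qed.

Lemma finitely_generated_embed (W : lmodType k) (V : vectType k)
    (g : {linear W -> V}) : injective g -> finitely_generated W.
Proof.
move=> gi; have [s [Ps sps]] := span_pred (fun y => exists w, g w = y).
pose t := in_tuple s.
have /choice[w gw] : forall i : 'I_(size s), exists w, g w = t`_i.
  by move=> i; apply: Ps; apply: mem_nth.
exists (size s), w => x; have gx : g x \in <<t>>%VS by apply: sps; exists x.
exists (fun i => coord t i (g x)); apply: gi.
rewrite [LHS](coord_span gx) linear_sum; apply: eq_bigr => i _.
by rewrite linearZ /= gw.
Qed.

Context (A : falgType k).

(** A copy of X carrying the structure of a k-vector space, kept apart from the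
A-module structure of X. *)
Definition kvec (X : lmodType A^c) : Type := X.

HB.instance Definition _ (X : lmodType A^c) := GRing.Zmodule.on (kvec X).

Section KScale.
Context (X : lmodType A^c).
Implicit Types x y : kvec X.

Definition kvec_scale (c : k) x : kvec X := kscale c (x : X).

Fact kvec_scaleA a b x : kvec_scale a (kvec_scale b x) = kvec_scale (a * b) x.
Proof.
rewrite /kvec_scale /kscale scalerA; congr (_ *: _).
by rewrite -[LHS]/((b%:A : A) * a%:A) -scalerAl mul1r scalerA mulrC.
Qed.
Fact kvec_scale1 : left_id 1 kvec_scale.
Proof. by move=> x; rewrite /kvec_scale /kscale scale1r -[RHS]scale1r. Qed.
Fact kvec_scaleDr : right_distributive kvec_scale +%R.
Proof. by move=> a x y; rewrite /kvec_scale /kscale scalerDr. Qed.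
Fact kvec_scaleDl x : {morph kvec_scale^~ x : a b / a + b}.
Proof. by move=> a b; rewrite /kvec_scale /kscale -scalerDl -scalerDl. Qed.

HB.instance Definition _ :=
  GRing.Zmodule_isLmodule.Build k (kvec X)
    kvec_scaleA kvec_scale1 kvec_scaleDr kvec_scaleDl.

Lemma kvec_scaleE (c : k) x : c *: x = kscale c (x : X).
Proof. by []. Qed.

Lemma kvec_scaleAl (c : k) (a : A) (x : X) :
  ((c *: a : A) : A^c) *: x = (c *: ((a : A^c) *: x : kvec X) : kvec X).
Proof.
rewrite kvec_scaleE /kscale scalerA; apply: (f_equal (fun b : A^c => b *: x)).
by rewrite -[RHS]/((a : A) * _%:A) -scalerAr mulr1.
Qed.

Lemma kvec_fg : finitely_generated (kvec X) -> finitely_generated X.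
Proof.
case=> n [e sp]; exists n, e => x; have [c] := sp x.
by exists (fun i => (c i)%:A : A).
Qed.

Lemma fg_kvec : finitely_generated X -> finitely_generated (kvec X).
Proof.
case=> n [e sp]; pose b := vbasis {: A}.
pose be (i : 'I_n) (j : 'I_(\dim {: A})) : kvec X := (b`_j : A^c) *: e i.
apply: (@finitely_generatedI k (kvec X) _ (fun ij => be ij.1 ij.2)) => x.
have [c ->] := sp x.
exists (fun ij => coord b ij.2 (c ij.1)).
rewrite -(pair_bigA _ (fun i j => coord b j (c i) *: be i j)) /=.
apply: eq_bigr => i _; rewrite {1}(coord_vbasis (memvf (c i : A))).
rewrite [LHS]scaler_suml; apply: eq_bigr => j _.
exact: kvec_scaleAl.
Qed.

End KScale.

Lemma linear_kvec (X Y : lmodType A^c) (f : {linear X -> Y}) :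
  linear (f : kvec X -> kvec Y).
Proof. by move=> a x y; rewrite -linearP. Qed.

Definition klin (X Y : lmodType A^c) (f : {linear X -> Y}) :
  {linear kvec X -> kvec Y} := lin (linear_kvec f).

Fact kvec_vector (X : fgmod A) : {m & Vector.axiom m (kvec X)}.
Proof.
have [m /cid[f fb]] := cid (finite_basis (fg_kvec (fgmodP X))).
have [g [fK gK]] := cid (linear_inverse fb).
by exists m, g; [apply: linearP | exists f].
Qed.

HB.instance Definition _ (X : fgmod A) :=
  Lmodule_hasFinDim.Build k (kvec X) (projT2 (kvec_vector X)).

End FiniteDimension.

(** * Direct sums, kernels and dimension *)

Section DirectSumMaps.
Context (R : nzRingType) (I : finType) (V : I -> lmodType R).
Local Notation dsum := {dffun forall i, V i}.

Fact dproj_linear i : linear (fun f : dsum => f i).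
Proof. by move=> a f g; rewrite !ffunE. Qed.
Definition dproj i : {linear dsum -> V i} := lin (@dproj_linear i).

Fact dinj_linear i :
  linear (fun x : V i => [ffun j => dfwith (fun j => 0 : V j) x j] : dsum).
Proof.
move=> a x y; apply/ffunP => j; rewrite !ffunE.
by case: (eqVneq i j) => [<-|ij]; rewrite ?dfwith_in // !dfwith_out //
  scaler0 addr0.
Qed.
Definition dinj i : {linear V i -> dsum} := lin (@dinj_linear i).

Lemma dinj_same i x : dinj i x i = x.
Proof. by rewrite ffunE dfwith_in. Qed.
Lemma dinj_other i j x : i != j -> dinj i x j = 0.
Proof. by move=> ij; rewrite ffunE dfwith_out. Qed.

Lemma dprojE i f : dproj i f = f i.
Proof. by []. Qed.

Lemma dsum_decomp (f : dsum) : f = \sum_i dinj i (f i).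
Proof.
apply/ffunP => j; rewrite -[RHS]/(dproj j _) linear_sum (bigD1 j) //=.
rewrite big1 ?addr0 -?[RHS]/(dinj j (f j) j) ?dinj_same // => i ij.
exact: dinj_other.
Qed.

Fact dtuple_linear (W : lmodType R) (u : forall i, {linear W -> V i}) :
  linear (fun w => [ffun i => u i w] : dsum).
Proof. by move=> a x y; apply/ffunP => i; rewrite !ffunE linearP. Qed.
Definition dtuple (W : lmodType R) (u : forall i, {linear W -> V i}) :
  {linear W -> dsum} := lin (dtuple_linear u).

Fact sum_linear (J : finType) (U W : lmodType R) (u : J -> {linear U -> W}) :
  linear (fun x => \sum_i u i x).
Proof.
move=> a x y; rewrite scaler_sumr -big_split /=.
by apply: eq_bigr => i _; rewrite linearP.
Qed.
Definition lsum (J : finType) (U W : lmodType R) (u : J -> {linear U -> W}) :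
  {linear U -> W} := lin (sum_linear u).

Lemma dtupleE (W : lmodType R) (u : forall i, {linear W -> V i}) w i :
  dtuple u w i = u i w.
Proof. by rewrite ffunE. Qed.

Definition dcotuple (W : lmodType R) (u : forall i, {linear V i -> W}) :
  {linear dsum -> W} := lsum (fun i => (u i \o dproj i)).

Lemma dcotupleE (W : lmodType R) (u : forall i, {linear V i -> W}) f :
  dcotuple u f = \sum_i u i (f i).
Proof. by []. Qed.

(** Recognizing a direct sum by its inclusions and projections: unlike
a bijection to dependent functions, this data can be reindexed without
transporting along equalities of indices. *)
Lemma iso_dsum (X : lmodType R) (inj : forall i, {linear V i -> X})
    (proj : forall i, {linear X -> V i}) :
  (forall i x, proj i (inj i x) = x) ->
  (forall i j x, i != j -> proj j (inj i x) = 0) ->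
  (forall x, \sum_i inj i (proj i x) = x) ->
  iso X dsum.
Proof.
move=> pi_same pi_other dec; exists (dtuple proj).
exists (dcotuple inj) => [x|f].
  by rewrite dcotupleE -[RHS]dec; apply: eq_bigr => i _; rewrite ffunE.
apply/ffunP => j; rewrite ffunE dcotupleE linear_sum (bigD1 j) //= pi_same.
by rewrite big1 ?addr0 // => i ij; apply: pi_other.
Qed.

End DirectSumMaps.


Section Finite.
Context (R : nzRingType).

Lemma reg_fg : finitely_generated R^o.
Proof.
exists 1%N, (fun=> 1) => x; exists (fun=> x).
by rewrite big_ord1 -[LHS]mulr1.
Qed.

Lemma prod_fg (M N : lmodType R) :
  finitely_generated M -> finitely_generated N ->
  finitely_generated (M * N)%type.
Proof.
move=> [m [e em]] [n [f fn]].
apply: (@finitely_generatedI _ (M * N)%type _ (fun i : 'I_m + 'I_n =>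
  match i with inl i => (e i, 0) | inr j => (0, f j) end)) => -[x y].
have [c ->] := em x; have [d ->] := fn y.
exists (fun i => match i with inl i => c i | inr j => d j end).
rewrite big_sumType [RHS]surjective_pairing /= !(raddf_sum fst) !(raddf_sum snd).
congr (_, _).
  by rewrite /= [X in _ + X]big1 ?addr0 // => i _; rewrite scaler0.
by rewrite /= [X in X + _]big1 ?add0r // => i _; rewrite scaler0.
Qed.

Lemma dsum_fg (I : finType) (V : I -> lmodType R) :
  (forall i, finitely_generated (V i)) ->
  finitely_generated {dffun forall i, V i}.
Proof.
move=> fgV; have /choice[n nP] i := fgV i.
have {nP} [e sp] : exists e : forall i, 'I_(n i) -> V i,
    forall i x, exists c : 'I_(n i) -> R, x = \sum_(j < n i) c j *: e i j.
  exists (fun i => projT1 (cid (nP i))) => i; exact: (projT2 (cid (nP i))).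
apply: (@finitely_generatedI _ _ {i : I & 'I_(n i)}
  (fun p => dinj V (tag p) (e _ (tagged p)))) => f.
have cP i : {c : 'I_(n i) -> R | f i = \sum_(j < n i) c j *: e i j}.
  exact/cid/sp.
exists (fun p => sval (cP (tag p)) (tagged p)).
rewrite [LHS]dsum_decomp -(sig_big_dep xpredT (fun _ => xpredT)
   (fun i (j : 'I_(n i)) => sval (cP i) j *: dinj V i (e i j))) /=.
apply: eq_bigr => i _; transitivity (dinj V i (\sum_j sval (cP i) j *: e i j)).
  by congr (dinj V i _); apply: (svalP (cP i)).
by rewrite linear_sum; apply: eq_bigr => j _; rewrite linearZ.
Qed.

Lemma surj_fg (M N : lmodType R) (g : {linear M -> N}) :
  surjective g -> finitely_generated M -> finitely_generated N.
Proof.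
move=> gs [n [e sp]]; exists n, (g \o e) => y; have [x <-] := gs y.
have [c ->] := sp x; exists c; rewrite linear_sum.
by apply: eq_bigr => i _; rewrite linearZ.
Qed.

End Finite.

Section FgMod.
Context (k : fieldType) (A : falgType k).
Implicit Types X Y Z T : fgmod A.

Definition mreg : fgmod A := FgMod (reg_fg A^c).
Definition mprod X Y : fgmod A := FgMod (prod_fg (fgmodP X) (fgmodP Y)).
Definition msum (I : finType) (S : I -> fgmod A) : fgmod A :=
  FgMod (dsum_fg (fun i => fgmodP (S i))).
Definition mpow (n : nat) X : fgmod A := msum (fun _ : 'I_n => X).
Definition mquot X (S : submodule X) : fgmod A :=
  FgMod (surj_fg (@quot_proj_surj _ _ S) (fgmodP X)).

(** Submodules of f.g. modules are f.g. because a spanning family over k is a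
generating family. *)
Lemma inj_fg (V : lmodType A^c) X (g : {linear V -> X}) :
  injective g -> finitely_generated V.
Proof.
move=> gi; apply: kvec_fg.
exact: (@finitely_generated_embed _ _ _ (klin g)).
Qed.

Definition msub X (S : submodule X) : fgmod A :=
  FgMod (inj_fg (@sub_incl_inj _ _ S)).

Definition mker X Y (f : {linear X -> Y}) : fgmod A := msub (kersub f).
Definition ker_incl X Y (f : {linear X -> Y}) : {linear mker f -> X} :=
  sub_incl (kersub f).

Lemma ker_incl_inj X Y (f : {linear X -> Y}) : injective (ker_incl f).
Proof. exact: sub_incl_inj. Qed.
Lemma ker_inclP X Y (f : {linear X -> Y}) x :
  f x = 0 <-> exists y, ker_incl f y = x.
Proof. exact: (sub_inclP (kersub f)). Qed.
Lemma ker_inclE X Y (f : {linear X -> Y}) y : f (ker_incl f y) = 0.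
Proof. by apply/ker_inclP; exists y. Qed.

Definition mdim X := \dim {: kvec X}.

Lemma bij_of_inj_surj (U V : Type) (f : U -> V) :
  injective f -> surjective f -> bijective f.
Proof. by move=> fi /choice[g gK]; exists g => // x; apply: fi. Qed.

Lemma surj_of_bij (U V : Type) (f : U -> V) : bijective f -> surjective f.
Proof. by case=> g _ gK y; exists (g y). Qed.

Lemma mdim_limg X Y (f : {linear X -> Y}) :
  (\dim (lker (linfun (klin f))) + \dim (limg (linfun (klin f))) = mdim X)%N.
Proof. by rewrite /mdim -(limg_ker_dim (linfun (klin f)) fullv) capfv. Qed.

Lemma lker_inj X Y (f : {linear X -> Y}) :
  injective f <-> lker (linfun (klin f)) = 0%VS.
Proof.
split=> [fi | /eqP/lker0P fi].
  by apply/eqP/lker0P => x y; rewrite !lfunE /=; apply: fi.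
by move=> x y fxy; apply: fi; rewrite !lfunE.
Qed.

Lemma limg_surj X Y (f : {linear X -> Y}) :
  surjective f <-> limg (linfun (klin f)) = fullv.
Proof.
split=> [fs | fE y].
  apply/eqP; rewrite eqEsubv subvf; apply/subvP => y _; have [x <-] := fs y.
  by apply/memv_imgP; exists (x : kvec X); rewrite ?memvf // lfunE.
have : (y : kvec Y) \in limg (linfun (klin f)) by rewrite fE memvf.
by case/memv_imgP => x _ ->; exists x; rewrite lfunE.
Qed.

Lemma mdim_inj_surj X Y (f : {linear X -> Y}) :
  injective f -> (mdim Y <= mdim X)%N -> surjective f.
Proof.
move=> /lker_inj f0; rewrite -(mdim_limg f) f0 dimv0 add0n => le.
by apply/limg_surj/eqP; rewrite eqEdim subvf.
Qed.

Lemma mdim_lt_inj X Y (f : {linear X -> Y}) y :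
  injective f -> (forall x, f x != y) -> (mdim X < mdim Y)%N.
Proof.
move=> fi ny; rewrite ltnNge; apply/negP => /(mdim_inj_surj fi)/(_ y)[x fx].
by have := ny x; rewrite fx eqxx.
Qed.

Lemma pair_l_linear (U V : lmodType A^c) : linear (fun x : U => (x, 0 : V)).
Proof. by move=> a x y; apply/eqP; rewrite xpair_eqE /= scaler0 addr0 !eqxx. Qed.
Lemma pair_r_linear (U V : lmodType A^c) : linear (fun y : V => (0 : U, y)).
Proof. by move=> a x y; apply/eqP; rewrite xpair_eqE /= scaler0 addr0 !eqxx. Qed.
Definition pinl (U V : lmodType A^c) : {linear U -> (U * V)%type} :=
  lin (@pair_l_linear U V).
Definition pinr (U V : lmodType A^c) : {linear V -> (U * V)%type} :=
  lin (@pair_r_linear U V).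


(** Induction on the dimension over k, which drops in a proper decomposition. *)
Lemma fgmod_ind (P : fgmod A -> Prop) :
  (forall X, (forall x : X, x = 0) -> P X) ->
  (forall X, indecomposable X -> P X) ->
  (forall X Y Z, iso X (Y * Z)%type -> P Y -> P Z -> P X) ->
  forall X, P X.
Proof.
move=> P0 Pi Pp X; have [n] := ubnP (mdim X); elim: n X => // n IH X lt.
have [X0 | Xn0] := pselect (forall x : X, x = 0); first exact: P0.
have [Xi | Xd] := pselect (indecomposable X); first exact: Pi.
have [Y [Z [XYZ [Yn0 Zn0]]]] : exists Y Z : fgmod A, iso X (Y * Z)%type /\
   (~ (forall y : Y, y = 0)) /\ ~ (forall z : Z, z = 0).
  apply: contrapT => H; apply: Xd; split.
    apply: contrapT => H'; apply: Xn0 => x; apply/eqP/negPn/negP => x0.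
    by apply: H'; exists x.
  move=> Y Z XYZ; apply: contrapT => /not_orP[Y0 Z0]; apply: H.
  by exists Y, Z.
have nz (V : lmodType A^c) : ~ (forall v : V, v = 0) -> exists v : V, v != 0.
  move=> H; apply: contrapT => H'; apply: H => v; apply/eqP/negPn/negP => v0.
  by apply: H'; exists v.
have [f /linear_inverse[g [fK gK]]] := XYZ.
have [[y y0] [z z0]] := (nz _ Yn0, nz _ Zn0).
apply: (Pp _ Y Z XYZ); apply: IH; apply: leq_trans (_ : mdim _ < mdim X)%N _ => //.
- apply: (@mdim_lt_inj _ _ (g \o @pinl Y Z) (g (0, z))).
    by apply: inj_comp (can_inj gK) _ => u v [].
  by move=> x; apply: contraNneq z0 => /(can_inj gK)[_ <-].
- apply: (@mdim_lt_inj _ _ (g \o @pinr Y Z) (g (y, 0))).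
    by apply: inj_comp (can_inj gK) _ => u v [].
  by move=> x; apply: contraNneq y0 => /(can_inj gK)[<-].
Qed.

Lemma pair_split (U V : lmodType A^c) (p : (U * V)%type) :
  pinl U V p.1 + pinr U V p.2 = p.
Proof. by case: p => y z; rewrite -[LHS]/(_ + _, _ + _) /= addr0 add0r. Qed.

Lemma pinlE (U V : lmodType A^c) x : pinl U V x = (x, 0).
Proof. by []. Qed.
Lemma pinrE (U V : lmodType A^c) x : pinr U V x = (0, x).
Proof. by []. Qed.
Lemma pinl1 (U V : lmodType A^c) x : (pinl U V x).1 = x.
Proof. by []. Qed.
Lemma pinl2 (U V : lmodType A^c) x : (pinl U V x).2 = 0.
Proof. by []. Qed.
Lemma pinr1 (U V : lmodType A^c) x : (pinr U V x).1 = 0.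
Proof. by []. Qed.
Lemma pinr2 (U V : lmodType A^c) x : (pinr U V x).2 = x.
Proof. by []. Qed.
Definition pairE := (pinl1, pinl2, pinr1, pinr2).

End FgMod.
(* Otherwise simplification exposes the underlying functions and hides that
   these maps are linear. *)
#[global] Opaque dproj dinj dtuple pinl pinr sub_incl ker_incl quot_proj.

(** * Summands of powers and the Krull-Schmidt argument *)

Section KrullSchmidt.
Context (k : fieldType) (A : falgType k).
Implicit Types X Y Z T N : fgmod A.

(** X is a direct summand of the power T^n, written with the components of the
two maps X -> T^n -> X.  This form composes easily; [retract_in_add] relates it
to the sums of summands of T. *)
Definition retract (X T : lmodType A^c) : Prop :=
  exists n (a : 'I_n -> {linear X -> T}) (b : 'I_n -> {linear T -> X}),
    forall x, \sum_i b i (a i x) = x.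

Lemma retractI (I : finType) (X T : lmodType A^c)
    (a : I -> {linear X -> T}) (b : I -> {linear T -> X}) :
  (forall x, \sum_i b i (a i x) = x) -> retract X T.
Proof.
move=> ab; exists #|I|, (a \o enum_val), (b \o enum_val) => x.
by rewrite -[RHS]ab [RHS](reindex _ (onW_bij _ (enum_val_bij I))).
Qed.

Lemma retract_split (X T : lmodType A^c) (a : {linear X -> T})
    (b : {linear T -> X}) : (forall x, b (a x) = x) -> retract X T.
Proof.
move=> ab; apply: (@retractI unit _ _ (fun=> a) (fun=> b)) => x.
by rewrite big_const card_unit /= addr0.
Qed.

Lemma retract_refl (X : lmodType A^c) : retract X X.
Proof. exact: (@retract_split _ _ idfun idfun). Qed.

Lemma retract_trans (X Y Z : lmodType A^c) :
  retract X Y -> retract Y Z -> retract X Z.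
Proof.
move=> [n [a [b ab]]] [m [c [d cd]]].
apply: (@retractI ('I_n * 'I_m)%type _ _ (fun ij => c ij.2 \o a ij.1)
  (fun ij => b ij.1 \o d ij.2)) => x.
rewrite -(pair_bigA _ (fun i j => b i (d j (c j (a i x))))) /= -[RHS]ab.
by apply: eq_bigr => i _; rewrite -linear_sum cd.
Qed.

Lemma retract_dsum (I : finType) (V : I -> lmodType A^c) (T : lmodType A^c) :
  (forall i, retract (V i) T) -> retract {dffun forall i, V i} T.
Proof.
move=> rV; have cV i := cid (rV i).
pose n i := projT1 (cV i).
have ca i := cid (projT2 (cV i)).
have cb i := cid (projT2 (ca i)).
pose a i : 'I_(n i) -> _ := projT1 (ca i).
pose b i : 'I_(n i) -> _ := projT1 (cb i).
apply: (@retractI {i : I & 'I_(n i)} _ _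
  (fun p => a (tag p) (tagged p) \o dproj V (tag p))
  (fun p => dinj V (tag p) \o b (tag p) (tagged p))) => x.
transitivity (\sum_i \sum_j dinj V i (b i j (a i j (x i)))).
  by rewrite (sig_big_dep xpredT (fun _ => xpredT)).
rewrite [RHS]dsum_decomp; apply: eq_bigr => i _; rewrite -linear_sum.
by congr (dinj V i _); apply: (projT2 (cb i)).
Qed.

Lemma retract_iso_prod (X Y Z T : lmodType A^c) :
  iso X (Y * Z)%type -> retract Y T -> retract Z T -> retract X T.
Proof.
move=> [f /linear_inverse[g [fK gK]]] [n [a [b ab]]] [m [c [d cd]]].
pose u i : {linear X -> T} := match i with
  | inl i => a i \o (fst \o f) | inr j => c j \o (snd \o f) end.
pose v i : {linear T -> X} := match i with
  | inl i => g \o (pinl Y Z \o b i) | inr j => g \o (pinr Y Z \o d j) end.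
apply: (@retractI ('I_n + 'I_m)%type _ _ u v) => x.
transitivity (\sum_i g (pinl Y Z (b i (a i (f x).1))) +
              \sum_j g (pinr Y Z (d j (c j (f x).2)))); first exact: big_sumType.
by rewrite -!linear_sum -linearD ab cd pair_split fK.
Qed.

(** If b a is invertible, then T is the direct sum of the image of a and of the
kernel of b. *)
Lemma summand_of_split X T (a : {linear X -> T}) (b : {linear T -> X}) :
  bijective (b \o a) -> is_summand X T.
Proof.
move=> ba; have [c [cK Kc]] := linear_inverse ba.
exists (mker b); apply: iso_sym.
have hl : linear (fun p : (X * mker b)%type => a p.1 + ker_incl b p.2).
  by move=> z x y /=; rewrite !linearP scalerDr addrACA.
have bh p : b (lin hl p) = b (a p.1) by rewrite /= linearD ker_inclE addr0.
exists (lin hl); apply: bij_of_inj_surj.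
  apply: kernel_injective => -[x y] hxy.
  have x0 : x = 0.
    by apply: (can_inj cK); rewrite linear0 /= -(bh (x, y)) hxy linear0.
  congr (_, _); rewrite ?x0 //; apply: (@ker_incl_inj _ _ _ _ b).
  by move: hxy; rewrite /= x0 !linear0 add0r.
move=> t; have /(ker_inclP b)[y yE] : b (t - a (c (b t))) = 0.
  by rewrite linearB /= [b (a _)](Kc (b t)) subrr.
by exists (c (b t), y); rewrite /= [X in _ + X]yE addrC subrK.
Qed.

Lemma linear_iter X (f : {linear X -> X}) n :
  exists g : {linear X -> X}, g =1 iter n f.
Proof.
elim: n => [|n [g gE]]; first by exists idfun.
by exists (f \o g) => x; rewrite /= gE.
Qed.

Lemma inj_bij X (f : {linear X -> X}) : injective f -> bijective f.
Proof. by move=> fi; apply: bij_of_inj_surj (mdim_inj_surj fi _). Qed.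


(** For h a power of f of minimal rank, h and h^2 have the same image and the
same kernel, so that N is the direct sum of the image and the kernel of h; one
of them is zero as N is indecomposable. *)
Lemma fitting N (f : {linear N -> N}) : indecomposable N ->
  bijective f \/ exists n, forall x, iter n f x = 0.
Proof.
move=> [_ Nind]; have /choice[g gE] := linear_iter f.
pose rk n := \dim (limg (linfun (klin (g n)))).
(* positive exponents only: injectivity of h must imply that of f *)
have exp : exists d, `[< exists n, rk n.+1 = d >].
  by exists (rk 1%N); apply/asboolP; exists 0%N.
have [_ /asboolP[n <-] rk_min] := ex_minnP exp.
pose h := g n.+1; pose h2 := g (n + n.+1).+1.
have hh x : h2 x = h (h x) by rewrite /h2 /h !gE -iterD.
have rk_h2 : (rk n.+1 <= \dim (limg (linfun (klin h2))))%N.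
  by apply: rk_min; apply/asboolP; exists (n + n.+1)%N.
have im_h2 x : exists y, h x = h (h y).
  have sub : (limg (linfun (klin h2)) <= limg (linfun (klin h)))%VS.
    apply/subvP => _ /memv_imgP[y _ ->]; apply/memv_imgP.
    by exists (h y : kvec N); rewrite ?memvf // !lfunE /= hh.
  have /eqP eq_im : limg (linfun (klin h2)) == limg (linfun (klin h)).
    by rewrite eqEdim sub.
  have : (h x : kvec N) \in limg (linfun (klin h2)).
    by rewrite eq_im; apply/memv_imgP; exists (x : kvec N); rewrite ?memvf // lfunE.
  by case/memv_imgP => y _; rewrite lfunE /= hh => ->; exists y.
have ker_h2 x : h (h x) = 0 -> h x = 0.
  have sub : (lker (linfun (klin h)) <= lker (linfun (klin h2)))%VS.
    by apply/subvP => y; rewrite !memv_ker !lfunE /= hh => /eqP->; rewrite linear0.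
  have /eqP eq_ker : lker (linfun (klin h)) == lker (linfun (klin h2)).
    rewrite eqEdim sub -(leq_add2r (\dim (limg (linfun (klin h2))))).
    rewrite mdim_limg -(mdim_limg h) leq_add2l; exact: rk_h2.
  have /[swap] hx0 : (x : kvec N) \in lker (linfun (klin h)) -> h x = 0.
    by rewrite memv_ker lfunE => /eqP.
  by apply; rewrite eq_ker memv_ker lfunE /= hh hx0.
pose inc := sub_incl (imsub h).
have incP u : exists x, inc u = h x.
  have /sub_inclP[x] : exists v, inc v = inc u by exists u.
  by exists x.
have jl : linear (fun p : (msub (imsub h) * mker h)%type =>
    inc p.1 + ker_incl h p.2).
  by move=> z x y /=; rewrite !linearP scalerDr addrACA.
have jb : bijective (lin jl).
  apply: bij_of_inj_surj.
    apply: kernel_injective => -[u v] /= uv0; have [x xE] := incP u.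
    have hx0 : h x = 0.
      apply: ker_h2; rewrite -xE; move/(congr1 h): uv0.
      by rewrite linearD ker_inclE addr0 linear0.
    have v0 : ker_incl h v = 0 by move: uv0; rewrite xE hx0 add0r.
    congr (_, _).
      by apply: (@sub_incl_inj _ _ (imsub h)); rewrite -/inc xE hx0 linear0.
    by apply: (@ker_incl_inj _ _ _ _ h); rewrite v0 linear0.
  move=> x; have [y hy] := im_h2 x.
  have /sub_inclP[u uE] : imsub h (h y) by exists y.
  have /(ker_inclP h)[v vE] : h (x - h y) = 0 by rewrite linearB /= -hy subrr.
  by exists (u, v); rewrite /= [inc u]uE vE addrC subrK.
have [im0 | ker0] := Nind _ _ (iso_sym (ex_intro _ (lin jl) jb)).
  right; exists n.+1 => x; rewrite -gE.
  have /sub_inclP[u <-] : imsub h (h x) by exists x.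
  by rewrite (im0 u) linear0.
left; apply: inj_bij; apply: kernel_injective => x fx0.
have /(ker_inclP h)[u <-] : h x = 0.
  by rewrite /h gE iterSr fx0 -gE linear0.
by rewrite (ker0 u) linear0.
Qed.

(** End(N) is local: if u inverts the sum and u f_0 is not bijective, it is
nilpotent by Fitting's lemma; then a kernel vector x of the remaining terms
satisfies x = u f_0 x, whence x = 0 by iteration. *)
Lemma indecomposable_local N n (f : 'I_n -> {linear N -> N}) :
  indecomposable N -> bijective (lsum f) -> exists i, bijective (f i).
Proof.
move=> Nind; elim: n f => [|n IH] f fb.
  have [[x x0] _] := Nind; case/eqP: x0; have [g fK _] := fb.
  by apply: (can_inj fK); rewrite /= !big_ord0.
have [u [fK uK]] := linear_inverse fb.
have fE x : lsum f x = f ord0 x + lsum (f \o lift ord0) x.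
  by rewrite /= big_ord_recl.
have [ufb | [m nil]] := fitting (u \o f ord0) Nind.
  exists ord0; apply: inj_bij; apply: (@inj_compr _ _ _ u).
  exact: bij_inj.
have [|i ib] := IH (f \o lift ord0); last by exists (lift ord0 i).
apply: inj_bij; apply: kernel_injective => x rx0.
have ux : u (f ord0 x) = x by rewrite -[RHS]fK fE rx0 addr0.
rewrite -(nil x); elim: {nil}m => //= m <-.
by rewrite ux.
Qed.

Lemma retract_summand N T : indecomposable N -> retract N T -> is_summand N T.
Proof.
move=> Nind [n [a [b ab]]].
have [|i ib] := @indecomposable_local N n (fun i => b i \o a i) Nind.
  by exists id => x; rewrite /= ab.
exact: summand_of_split ib.
Qed.

Lemma in_addI (I : finType) (S : I -> fgmod A) T X
    (inj : forall i, {linear S i -> X}) (proj : forall i, {linear X -> S i}) :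
  (forall i, is_summand (S i) T) ->
  (forall i x, proj i (inj i x) = x) ->
  (forall i j x, i != j -> proj j (inj i x) = 0) ->
  (forall x, \sum_i inj i (proj i x) = x) ->
  in_add T X.
Proof.
move=> ST ps po dec; exists #|I|, (S \o enum_val); split=> [i|]; first exact: ST.
apply: (@iso_dsum _ _ (fun i : 'I_#|I| => S (enum_val i) : lmodType A^c) X
  (fun i => inj (enum_val i)) (fun i => proj (enum_val i))) => [i x|i j x ij|x].
- exact: ps.
- by apply: po; rewrite (inj_eq enum_val_inj).
by rewrite -[RHS]dec [RHS](reindex _ (onW_bij _ (enum_val_bij I))).
Qed.

Lemma dsum_of_in_add T X : in_add T X -> exists d (S : 'I_d -> fgmod A)
  (inj : forall i, {linear S i -> X}) (proj : forall i, {linear X -> S i}),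
  [/\ forall i, is_summand (S i) T,
      forall i x, proj i (inj i x) = x,
      forall i j x, i != j -> proj j (inj i x) = 0 &
      forall x, \sum_i inj i (proj i x) = x].
Proof.
move=> [d [S [ST [f /linear_inverse[g [fK gK]]]]]].
pose V i : lmodType A^c := S i.
exists d, S, (fun i => g \o dinj V i), (fun i => dproj V i \o f).
split=> // [i x|i j x ij|x] /=.
- by rewrite gK; apply: (dinj_same (V := V)).
- by rewrite gK; apply: (dinj_other (V := V)).
by rewrite -linear_sum -[RHS]fK; congr (g _); rewrite [RHS](dsum_decomp (V := V)).
Qed.

Lemma in_add_iso_prod T X Y Z :
  iso X (Y * Z)%type -> in_add T Y -> in_add T Z -> in_add T X.
Proof.
move=> [f /linear_inverse[g [fK gK]]].
move=> /dsum_of_in_add[d1 [S1 [i1 [p1 [T1 s1 o1 e1]]]]].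
move=> /dsum_of_in_add[d2 [S2 [i2 [p2 [T2 s2 o2 e2]]]]].
pose S (i : 'I_d1 + 'I_d2) := match i with inl i => S1 i | inr i => S2 i end.
pose inj i : {linear S i -> X} := match i with
  | inl i => g \o (pinl Y Z \o i1 i) | inr i => g \o (pinr Y Z \o i2 i) end.
pose proj i : {linear X -> S i} := match i with
  | inl i => p1 i \o (fst \o f) | inr i => p2 i \o (snd \o f) end.
apply: (@in_addI _ S T X inj proj).
- by case.
- by case=> i x /=; rewrite gK pairE ?s1 ?s2.
- case=> i [] j x ij /=; rewrite gK pairE; try exact: linear0.
    by apply: o1; apply: contraNneq ij => ->.
  by apply: o2; apply: contraNneq ij => ->.
move=> x; transitivity (\sum_i g (pinl Y Z (i1 i (p1 i (f x).1))) +
  \sum_j g (pinr Y Z (i2 j (p2 j (f x).2)))); first exact: big_sumType.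
by rewrite -!linear_sum -linearD e1 e2 pair_split fK.
Qed.

Lemma in_add_zero T X : (forall x : X, x = 0) -> in_add T X.
Proof.
move=> X0; apply: (@in_addI void (fun i => match i with end) _ _
  (fun i => match i with end) (fun i => match i with end)); try by case.
by move=> x; rewrite [RHS]X0; apply: X0.
Qed.

Lemma in_add_summand T X : is_summand X T -> in_add T X.
Proof.
move=> XT; apply: (@in_addI unit (fun=> X) _ _ (fun=> idfun) (fun=> idfun)) => //.
by move=> x; rewrite big_const card_unit /= addr0.
Qed.

(** The Krull-Schmidt argument: decompose X into indecomposables; each one is a
summand of a power of T and has a local endomorphism ring, hence is a summand
of T itself. *)
Lemma retract_in_add T X : retract X T -> in_add T X.
Proof.
elim/fgmod_ind: X => [X X0 _|X Xi XT|X Y Z XYZ IY IZ XT].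
- exact: in_add_zero.
- exact/in_add_summand/retract_summand.
have [f /linear_inverse[g [fK gK]]] := XYZ.
apply: (in_add_iso_prod XYZ); [apply: IY|apply: IZ]; apply: retract_trans XT.
  by apply: (@retract_split _ _ (g \o pinl Y Z) (fst \o f)) => y /=; rewrite gK pairE.
by apply: (@retract_split _ _ (g \o pinr Y Z) (snd \o f)) => y /=; rewrite gK pairE.
Qed.

End KrullSchmidt.

(** * Projective, injective and generated modules *)

Section ProjectiveInjective.
Context (k : fieldType) (A : falgType k).
Implicit Types P Q X Y Z T M : fgmod A.

Definition injective_module Q : Prop :=
  forall X Y (i : {linear X -> Y}) (f : {linear X -> Q}),
    injective i -> exists h : {linear Y -> Q}, forall x, h (i x) = f x.

Fact elt_linear (X : lmodType A^c) (x : X) : linear (fun a : A^c^o => a *: x).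
Proof. by move=> c a b; rewrite scalerDl scalerA. Qed.
(** The map 1 |-> x of the isomorphism Hom_A(A, X) = X. *)
Definition elt (X : lmodType A^c) (x : X) : {linear A^c^o -> X} :=
  lin (elt_linear x).

Lemma elt1 (X : lmodType A^c) (f : {linear A^c^o -> X}) a :
  f a = elt (f 1) a.
Proof. by rewrite /= -linearZ /=; congr (f _); rewrite -[RHS]/(a * 1) mulr1. Qed.

Lemma reg_projective : projective (mreg A).
Proof.
move=> M N g f gs; have [m gm] := gs (f (1 : A^c^o)).
by exists (elt m) => a; rewrite (elt1 f) /= linearZ /= gm.
Qed.

Lemma free_cover X : exists n (g : {linear mpow n (mreg A) -> X}), surjective g.
Proof.
have [n [e sp]] := fgmodP X; exists n.
exists (dcotuple (V := fun=> A^c^o) (fun i => elt (e i))) => x.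
by have [c ->] := sp x; exists [ffun i => c i]; rewrite dcotupleE;
  apply: eq_bigr => i _; rewrite ffunE.
Qed.

Lemma projective_retract P X : retract X P -> projective P -> projective X.
Proof.
move=> [n [a [b ab]]] Pp M N g f gs.
have /choice[h hE] i := Pp _ _ g (f \o b i) gs.
exists (lsum (fun i => h i \o a i)) => x /=.
rewrite linear_sum -[in RHS](ab x) linear_sum.
by apply: eq_bigr => i _; rewrite hE.
Qed.

Lemma injective_retract Q X :
  retract X Q -> injective_module Q -> injective_module X.
Proof.
move=> [n [a [b ab]]] Qi Y Z i f ii.
have /choice[h hE] j := Qi _ _ i (a j \o f) ii.
exists (lsum (fun j => b j \o h j)) => x /=.
by rewrite -[RHS]ab; apply: eq_bigr => j _; rewrite hE.
Qed.

Lemma pow_retract n T : retract (mpow n T) T.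
Proof. by apply: retract_dsum => _; apply: retract_refl. Qed.

Lemma prod_retract X Y T :
  retract X T -> retract Y T -> retract (mprod X Y) T.
Proof. by apply: retract_iso_prod; exists idfun; exists id. Qed.

Lemma fst_retract X Y : retract X (mprod X Y).
Proof. by apply: (retract_split (a := pinl X Y) (b := fst)) => x; apply: pinl1. Qed.
Lemma snd_retract X Y : retract Y (mprod X Y).
Proof. by apply: (retract_split (a := pinr X Y) (b := snd)) => x; apply: pinr2. Qed.

Lemma projective_reg_retract P : projective P -> retract P (mreg A).
Proof.
move=> Pp; have [n [g gs]] := free_cover P.
have [s sE] := Pp _ _ g idfun gs.
exact: retract_trans (retract_split sE) (pow_retract n _).
Qed.

Lemma projective_prod X Y :
  projective X -> projective Y -> projective (mprod X Y).
Proof.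
move=> /projective_reg_retract Xr /projective_reg_retract Yr.
exact: projective_retract (prod_retract Xr Yr) reg_projective.
Qed.

Lemma projective_pow n P : projective P -> projective (mpow n P).
Proof. exact/projective_retract/pow_retract. Qed.
Lemma injective_pow n Q : injective_module Q -> injective_module (mpow n Q).
Proof. exact/injective_retract/pow_retract. Qed.

(** Y is a quotient of a power of Q, in terms of the components of the
epimorphism. *)
Definition generates Q Y : Prop :=
  exists n (u : 'I_n -> {linear Q -> Y}),
    forall y, exists q : 'I_n -> Q, y = \sum_i u i (q i).

Lemma generatesI (I : finType) Q Y (u : I -> {linear Q -> Y}) :
  (forall y, exists q : I -> Q, y = \sum_i u i (q i)) -> generates Q Y.
Proof.
move=> gen; exists #|I|, (u \o enum_val) => y; have [q ->] := gen y.
by exists (q \o enum_val); rewrite (reindex _ (onW_bij _ (enum_val_bij I))).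
Qed.

Lemma generates_surj Q X Y (g : {linear X -> Y}) :
  surjective g -> generates Q X -> generates Q Y.
Proof.
move=> gs [n [u gen]]; exists n, (fun i => g \o u i) => y.
by have [x <-] := gs y; have [q ->] := gen x; exists q; rewrite linear_sum.
Qed.

Lemma generates_pow n Q : generates Q (mpow n Q).
Proof.
exists n, (dinj (fun _ : 'I_n => Q : lmodType A^c)) => y; exists y.
exact: dsum_decomp.
Qed.

Lemma generates_trans Q T Y : generates Q T -> generates T Y -> generates Q Y.
Proof.
move=> [n [u genT]] [m [v genY]].
apply: (@generatesI ('I_m * 'I_n)%type _ _ (fun ij => v ij.1 \o u ij.2)) => y.
have [t ->] := genY y; have /choice[q qE] i := genT (t i).
exists (fun ij => q ij.1 ij.2).
rewrite -(pair_bigA _ (fun i j => v i (u j (q i j)))) /=.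
by apply: eq_bigr => i _; rewrite {1}qE linear_sum.
Qed.

Lemma in_Gen_generates T Y : in_Gen T Y -> generates T Y.
Proof.
move=> [n [g gs]].
have il i : linear (fun t : T =>
    [ffun j => if i == j then t else 0] : {ffun 'I_n -> T}).
  move=> a x y; apply/ffunP => j; rewrite !ffunE.
  by case: eqP => // _; rewrite scaler0 addr0.
exists n, (fun i => g \o lin (il i)) => y; have [t <-] := gs y; exists t.
rewrite -[RHS](linear_sum g) /=; congr (g _); apply/ffunP => j.
rewrite sum_ffunE (bigD1 j) //= ffunE eqxx big1 ?addr0 // => i ij.
by rewrite ffunE (negPf ij).
Qed.

Lemma generates_power Q Y : generates Q Y ->
  exists n (g : {linear mpow n Q -> Y}), surjective g.
Proof.
move=> [n [u gen]]; exists n, (dcotuple (V := fun=> Q : lmodType A^c) u) => y.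
have [q ->] := gen y; exists [ffun i => q i]; rewrite dcotupleE.
by apply: eq_bigr => i _; rewrite ffunE.
Qed.

(** Lift f to a map P -> Q^n, extend it to X by injectivity of Q^n, and go down
to Y again. *)
Lemma extend_to_generated Q P X Y (i : {linear P -> X}) (f : {linear P -> Y}) :
  injective_module Q -> generates Q Y -> projective P -> injective i ->
  exists h : {linear X -> Y}, forall x, h (i x) = f x.
Proof.
move=> Qi /generates_power[n [g gs]] Pp ii.
have [l lE] := Pp _ _ g f gs.
have [h hE] := injective_pow (n := n) Qi l ii.
by exists (g \o h) => x /=; rewrite hE lE.
Qed.

(** Ext^1(X, Y) is the cokernel of Hom(P0, Y) -> Hom(P1, Y) for a resolution
0 -> P1 -> P0 -> X -> 0, and that map is onto by [extend_to_generated]. *)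
Lemma Ext1_generated Q X Y :
  injective_module Q -> generates Q Y -> pd_le 1 X -> Ext1_eq0 X Y.
Proof.
move=> Qi gen [P1 [P0 [i [p [P0p [ii ip ps] P1p]]]]] E f g [fi fg gs].
have [l lE] := P0p _ _ g p gs.
have [c cE] : exists c : {linear P1 -> Y}, forall x, f (c x) = l (i x).
  apply: (@factor_injective _ _ _ _ f (l \o i)) => // x; apply/fg.
  by rewrite /= lE; apply/ip; exists x.
have [h hE] := extend_to_generated c Qi gen P1p ii.
have [s sE] : exists s : {linear X -> E}, forall x, s (p x) = l x - f (h x).
  apply: (@factor_surjective _ _ _ _ p (l \- (f \o h))) => // x /ip[y <-].
  by rewrite /= hE cE subrr.
exists s => x; have [y <-] := ps x; rewrite sE linearB /= lE.
by rewrite [X in _ - X](_ : _ = 0) ?subr0 //; apply/fg; exists (h y).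
Qed.

(** Let 0 -> R1 -> R0 -> X -> 0 be a resolution and p : P -> Y a free cover.
The map P -> X lifts to l : P -> R0, and the kernel of p is isomorphic to the
kernel of (l, - f) : P + R1 -> R0, a map between projectives. *)
Lemma pd_le1_sub X Y (i : {linear Y -> X}) :
  (forall P P' (f : {linear P -> P'}),
     projective P -> projective P' -> projective (mker f)) ->
  injective i -> pd_le 1 X -> pd_le 1 Y.
Proof.
move=> kerp ii [R1 [R0 [f [g [R0p [fi fg gs] R1p]]]]].
have [n [p ps]] := free_cover Y; set P := mpow n _ in p ps.
have Pp : projective P by exact/projective_pow/reg_projective.
have [l lE] := Pp _ _ g (i \o p) gs.
have dl : linear (fun z : mprod P R1 => l z.1 - f z.2).
  by move=> a x y /=; rewrite !linearP addrACA -scalerDr.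
pose d : {linear mprod P R1 -> R0} := lin dl.
exists (mker d), P, (fst \o ker_incl d), p; split=> //; last first.
  by apply: kerp => //; apply: projective_prod.
have dE z : d z = 0 -> l z.1 = f z.2 by move/subr0_eq.
split=> // [|x].
  apply: kernel_injective => z /= z1; apply: (@ker_incl_inj _ _ _ _ d).
  rewrite linear0 [LHS]surjective_pairing z1; congr (_, _); apply: fi.
  by rewrite -dE ?ker_inclE // z1 !linear0.
split=> [px0 | [z <-] /=]; last first.
  apply: ii; rewrite linear0; move: (lE (ker_incl d z).1) => /= <-.
  by apply/fg; exists (ker_incl d z).2; rewrite dE // ker_inclE.
have /fg[r rE] : g (l x) = 0 by rewrite lE /= px0 linear0.
have /(ker_inclP d)[z zE] : d (x, r) = 0 by rewrite /= rE subrr.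
by exists z; rewrite /= zE.
Qed.

Lemma pd_le1_prod P X : projective P -> pd_le 1 X -> pd_le 1 (mprod P X).
Proof.
move=> Pp [R1 [R0 [f [g [R0p [fi fg gs] R1p]]]]].
have hl : linear (fun z : mprod P R0 => (z.1, g z.2) : mprod P X).
  by move=> a x y; rewrite /= linearP.
exists R1, (mprod P R0), (pinr P R0 \o f), (lin hl); split=> //.
  exact: projective_prod.
split=> [|[x r]|[x y]].
- by apply: inj_comp fi => x y /(congr1 snd); rewrite !pairE.
- split=> [[-> /fg[z <-]] | [z]]; first by exists z; rewrite /= pinrE.
  by rewrite /= pinrE => -[<- <-]; congr (_, _); apply/fg; exists z.
by have [r <-] := gs y; exists (x, r).
Qed.

End ProjectiveInjective.

(** * The canonical tilting module *)

Section PowerMaps.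
Context (k : fieldType) (A : falgType k).
Implicit Types X Y Z : fgmod A.

Definition mpow_map n X Y (f : {linear X -> Y}) :
    {linear mpow n X -> mpow n Y} :=
  dtuple (V := fun _ : 'I_n => Y : lmodType A^c)
    (fun i => f \o dproj (fun=> X : lmodType A^c) i).

Lemma mpow_mapE n X Y (f : {linear X -> Y}) (x : mpow n X) i :
  mpow_map n f x i = f (x i).
Proof. by rewrite /mpow_map dtupleE. Qed.

Lemma short_exact_mpow n X Y Z (f : {linear X -> Y}) (g : {linear Y -> Z}) :
  short_exact f g -> short_exact (mpow_map n f) (mpow_map n g).
Proof.
move=> [fi fg gs]; split=> [x y fxy | y | z].
- by apply/ffunP => i; apply: fi; rewrite -!mpow_mapE fxy.
- split=> [gy | [x <-]]; last first.
    by apply/ffunP => i; rewrite !mpow_mapE ffunE; apply/fg; exists (x i).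
  have /choice[x xE] i : exists x, f x = y i.
    by apply/fg; rewrite -mpow_mapE gy ffunE.
  by exists [ffun i => x i]; apply/ffunP => i; rewrite mpow_mapE ffunE.
have /choice[y yE] i := gs (z i).
by exists [ffun i => y i]; apply/ffunP => i; rewrite mpow_mapE ffunE.
Qed.
End PowerMaps.

Section CanonicalTilting.
Context (k : fieldType) (A : falgType k).
Implicit Types X Y Z M : fgmod A.
Context (Q C : fgmod A) (j : {linear mreg A -> Q}) (pi : {linear Q -> C}).
Context (Qp : projective Q) (Qi : injective_module Q).
Context (jpi : short_exact j pi).

Let T := mprod Q C.

Lemma generates_T : generates Q T.
Proof.
have [_ _ pis] := jpi.
pose u (b : bool) : {linear Q -> T} :=
  if b then pinl Q C else pinr Q C \o pi.
apply: (generatesI (u := u)).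
move=> [q c]; have [r <-] := pis c; exists (fun b => if b then q else r).
rewrite big_bool /= pinlE pinrE.
by rewrite -[RHS]/(_ + _, _ + _) /= addr0 add0r.
Qed.

(** M is the quotient of Q^a by the image of some u : A^m -> Q^a.  As Q is
injective, u extends along J : A^m -> Q^m to some ub : Q^m -> Q^a.  Then
(q, [r]) |-> q + ub r is well defined from Q^a + C^m to M; it is onto, and its
kernel is the image of Q^m under s |-> (- ub s, [s]). *)
Lemma approximation M : generates Q M ->
  exists (N : fgmod A) (f : {linear N -> M}),
    [/\ retract N T, pd_le 1 N, surjective f & generates Q (mker f)].
Proof.
move=> /generates_power[a [v vs]].
have [m [w ws]] := free_cover (mker v).
have Jex := short_exact_mpow m jpi.
set J := mpow_map m j in Jex; set Pi := mpow_map m pi in Jex.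
have [Ji JPi Pis] := Jex.
have PJ x : Pi (J x) = 0 by apply/JPi; exists x.
pose u := ker_incl v \o w.
have [ub ubE] := injective_pow (n := a) Qi u Ji.
have vub x : v (ub (J x)) = 0 by rewrite ubE; apply: ker_inclE.
have [th thE] : exists th : {linear mpow m C -> M},
    forall x, th (Pi x) = v (ub x).
  apply: (@factor_surjective _ _ _ _ Pi (v \o ub)) => // x /JPi[y <-].
  exact: vub.
pose N := mprod (mpow a Q) (mpow m C).
have fl : linear (fun z : N => v z.1 + th z.2).
  by move=> c x y /=; rewrite !linearP scalerDr addrACA.
pose f : {linear N -> M} := lin fl.
exists N, f; split.
- apply: prod_retract; apply: retract_trans (pow_retract _ _) _.
    exact: fst_retract.
  exact: snd_retract.
- apply: pd_le1_prod; first exact: projective_pow.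
  exists (mpow m (mreg A)), (mpow m Q), J, Pi; split=> //.
    exact: projective_pow.
  exact/projective_pow/reg_projective.
- by move=> y; have [x <-] := vs y; exists (x, 0); rewrite /= linear0 addr0.
have sl : linear (fun s : mpow m Q => (- ub s, Pi s) : N).
  move=> c x y; rewrite !linearP; congr (_, _).
pose s : {linear mpow m Q -> N} := lin sl.
have [t tE] : exists t : {linear mpow m Q -> mker f},
    forall x, ker_incl f (t x) = s x.
  apply: factor_injective (@ker_incl_inj _ _ _ _ f) _ => x; apply/ker_inclP.
  by rewrite /= thE linearN addNr.
apply: (generates_surj (g := t)) (generates_pow m Q) => z.
case zE : (ker_incl f z) => [q c]; move: zE.
have [r <-] := Pis c => zE; have := ker_inclE z.
rewrite zE /= thE -linearD => /(ker_inclP v)[y yE].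
have [b bE] := ws y.
exists (r - J b); apply: (@ker_incl_inj _ _ _ _ f); rewrite tE zE /=.
congr (_, _); first by rewrite linearB ubE /= bE yE opprB addrK.
by rewrite linearB PJ subr0.
Qed.

Lemma canonical_tilting : tilting T.
Proof.
have pdT : pd_le 1 T.
  apply: pd_le1_prod => //; exists (mreg A), Q, j, pi; split=> //.
  exact: reg_projective.
split=> //; first exact: Ext1_generated Qi generates_T pdT.
exists Q, C, j, pi; split=> //; apply: retract_in_add.
  exact: fst_retract.
exact: snd_retract.
Qed.

(** The kernel of the approximation of M is generated by Q and has projective
dimension at most 1, so that its own approximation splits. *)
Lemma canonical_hereditary :
  (forall (P P' : fgmod A) (f : {linear P -> P'}),
     projective P -> projective P' -> projective (mker f)) ->
  hereditary_property T.
Proof.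
move=> kerp M /in_Gen_generates/(generates_trans generates_T)/approximation.
case=> N [f [NT pdN fs genK]].
exists (mker f), N, (ker_incl f), f; split; last 1 first.
- by split=> //; [apply: ker_incl_inj | apply: ker_inclP].
- apply: retract_in_add.
  have pdK := pd_le1_sub kerp (@ker_incl_inj _ _ _ _ f) pdN.
  have [N' [f' [NT' _ fs' genK']]] := approximation genK.
  have [|s sE] := Ext1_generated Qi genK' pdK
    (E := N') (f := ker_incl f') (g := f').
    by split=> //; [apply: ker_incl_inj | apply: ker_inclP].
  exact: retract_trans (retract_split sE) NT'.
exact: retract_in_add.
Qed.

End CanonicalTilting.

Theorem tilting_hereditary_of_embedding (k : fieldType) (A : falgType k)
    (Q : fgmod A) (j : {linear mreg A -> Q}) :
  projective Q -> injective_module Q -> injective j ->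
  (forall (P P' : fgmod A) (f : {linear P -> P'}),
     projective P -> projective P' -> projective (mker f)) ->
  exists T : fgmod A, tilting T /\ hereditary_property T.
Proof.
move=> Qp Qi ji kerp.
have jpi : short_exact j (quot_proj (imsub j) : {linear Q -> mquot (imsub j)}).
  by split=> //; [apply: quot_proj_eq0 | apply: quot_proj_surj].
exists (mprod Q (mquot (imsub j))); split.
  exact: canonical_tilting jpi.
exact: canonical_hereditary jpi kerp.
Qed.

(** * Equivalences of module categories *)

Lemma projective_iso (k : fieldType) (A : falgType k) (X Y : fgmod A)
    (f : {linear X -> Y}) : bijective f -> projective X -> projective Y.
Proof.
move=> /linear_inverse[g [_ gK]].
exact: projective_retract (retract_split gK).
Qed.

Section Functor.
Context (k : fieldType) (A B : falgType k) (F : linear_functor A B).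
Implicit Types X Y Z : fgmod A.

Lemma kscale0 (C : falgType k) (M : lmodType C^c) (x : M) : kscale 0 x = 0.
Proof. by rewrite /kscale scale0r [LHS]scale0r. Qed.

Lemma kscale1 (C : falgType k) (M : lmodType C^c) (x : M) : kscale 1 x = x.
Proof. by rewrite /kscale scale1r [LHS]scale1r. Qed.

Lemma fmap_ext X Y (f g : {linear X -> Y}) : f =1 g -> fmap F f =1 fmap F g.
Proof.
move=> fg y; rewrite (@fmap_lin _ _ _ F _ _ 0 f g f) ?kscale0 ?add0r // => x.
by rewrite kscale0 add0r.
Qed.

Lemma fmap0 X Y (f : {linear X -> Y}) : f =1 (fun=> 0) -> fmap F f =1 (fun=> 0).
Proof.
move=> f0 y; apply: (addrI (fmap F f y)); rewrite addr0.
rewrite [RHS](@fmap_lin _ _ _ F _ _ 1 f f f) ?kscale1 // => x.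
by rewrite kscale1 f0 addr0.
Qed.

Lemma fmap_compE X Y Z (f : {linear X -> Y}) (g : {linear Y -> Z}) x :
  fmap F (g \o f) x = fmap F g (fmap F f x).
Proof. exact: (@fmap_comp _ _ _ F _ _ _ f g (g \o f) (fun=> erefl) x). Qed.

End Functor.

Section QuasiInverse.
Context (k : fieldType) (A B : falgType k).
Context (F : linear_functor A B) (G : linear_functor B A).
Context (FG : left_quasi_inverse F G).

Lemma quasi_inverse_faithful (X Y : fgmod A) (f g : {linear X -> Y}) :
  fmap F f =1 fmap F g -> f =1 g.
Proof.
have [eta [etab nat]] := FG => fg x; apply: (bij_inj (etab Y)).
by rewrite !nat; apply: fmap_ext.
Qed.
End QuasiInverse.

Section Equivalence.
Context (k : fieldType) (A B : falgType k).
Context (F : linear_functor A B) (G : linear_functor B A).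
Context (FG : left_quasi_inverse F G) (GF : left_quasi_inverse G F).

(** The preimage of g is G g transported along the unit; it is mapped to g
because G is faithful. *)
Lemma equivalence_full (X Y : fgmod A) (g : {linear F X -> F Y}) :
  exists f : {linear X -> Y}, fmap F f =1 g.
Proof.
have [eta [etab nat]] := FG.
have [e [eK Ke]] := linear_inverse (etab Y).
exists (e \o fmap G g \o eta X); apply: (quasi_inverse_faithful GF) => z.
have [x <-] := surj_of_bij (etab X) z.
by rewrite -nat /= Ke.
Qed.

(** An element of F X is not visible inside mod A, but it is a map from the
regular module of B, which corresponds to a map w : Z -> X in mod A; a map f
whose image under F kills the element satisfies f w = 0.  This replaces
elements by morphisms in the proofs that F is exact. *)
Lemma equivalence_elt (X : fgmod A) (y : F X) :
  exists (Z : fgmod A) (w : {linear Z -> X}) (z : F Z), fmap F w z = y /\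
    forall (Y : fgmod A) (f : {linear X -> Y}), fmap F f y = 0 ->
      forall x, f (w x) = 0.
Proof.
have [eps [epsb _]] := GF; pose R := mreg B.
have [e [eK Ke]] := linear_inverse (epsb R).
have [w wE] := equivalence_full (elt y \o e).
exists (G R), w, (eps R (1 : B^c^o)); split=> [|Y f fy0 x].
  by rewrite wE /= eK scale1r.
apply: (quasi_inverse_faithful FG (f := f \o w) (g := \0)) => v.
rewrite [RHS]fmap0 // fmap_compE wE /= linearZ /= fy0.
exact: scaler0.
Qed.

Lemma equivalence_injective (X Y : fgmod A) (f : {linear X -> Y}) :
  injective f -> injective (fmap F f).
Proof.
move=> fi; apply: kernel_injective => y fy0.
have [Z [w [z [wy /(_ _ f fy0) w0]]]] := equivalence_elt y.
by rewrite -wy; apply: fmap0 => x; apply: fi; rewrite linear0 w0.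
Qed.

Lemma equivalence_kernel (K X Y : fgmod A) (i : {linear K -> X})
    (f : {linear X -> Y}) :
  injective i -> (forall x, f x = 0 <-> exists y, i y = x) ->
  forall x, fmap F f x = 0 <-> exists y, fmap F i y = x.
Proof.
move=> ii iP x; split=> [fx0 | [y <-]]; last first.
  by rewrite -fmap_compE fmap0 // => z; apply/iP; exists z.
have [Z [w [z [wx /(_ _ f fx0) w0]]]] := equivalence_elt x.
have [|v vE] := factor_injective (f := w) ii.
  by move=> t; apply/iP; apply: w0.
exists (fmap F v z); rewrite -wx -fmap_compE; apply: fmap_ext => t.
exact: vE.
Qed.

(** The projection onto the cokernel C of F f corresponds to a map
v : Y -> G C with v f = 0; so v = 0 and C = 0. *)
Lemma equivalence_surjective (X Y : fgmod A) (f : {linear X -> Y}) :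
  surjective f -> surjective (fmap F f).
Proof.
move=> fs y; pose C := mquot (imsub (fmap F f)).
have [eps [epsb _]] := GF.
have [v vE] := equivalence_full
  (eps C \o quot_proj (imsub (fmap F f)) : {linear F Y -> F (G C)}).
apply/(quot_proj_eq0 (imsub (fmap F f))); apply: (bij_inj (epsb C)).
rewrite linear0 -[LHS]vE; apply: fmap0 => t; have [x <-] := fs t.
apply: (quasi_inverse_faithful FG (f := v \o f) (g := \0)) => u.
rewrite [RHS]fmap0 // fmap_compE vE /= -[RHS](linear0 (eps C)); congr (eps C _).
by apply/quot_proj_eq0; exists u.
Qed.

End Equivalence.

Section EquivalenceProjInj.
Context (k : fieldType) (A B : falgType k).
Context (F : linear_functor A B) (G : linear_functor B A).
Context (FG : left_quasi_inverse F G) (GF : left_quasi_inverse G F).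

(** The lifting problem is moved to mod A by fullness, rather than by applying
G: no compatibility between the two natural isomorphisms is assumed. *)
Lemma equivalence_projective (P : fgmod A) : projective P -> projective (F P).
Proof.
move=> Pp M N g f gs; have [eps [epsb nat]] := GF.
have [f1 f1E] := equivalence_full FG GF (eps N \o f : {linear F P -> F (G N)}).
have [h hE] := Pp _ _ (fmap G g) f1 (equivalence_surjective GF FG gs).
have [e [eK Ke]] := linear_inverse (epsb M).
exists (e \o fmap F h) => y; apply: (bij_inj (epsb N)).
rewrite nat /= Ke -[RHS]f1E -fmap_compE; apply: fmap_ext => x; exact: hE.
Qed.

Lemma equivalence_injective_module (Q : fgmod A) :
  injective_module Q -> injective_module (F Q).
Proof.
move=> Qi X Y i f ii; have [eps [epsb nat]] := GF.
have [e [eK Ke]] := linear_inverse (epsb X).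
have [f1 f1E] := equivalence_full FG GF (f \o e : {linear F (G X) -> F Q}).
have [h hE] := Qi _ _ (fmap G i) f1 (equivalence_injective GF FG ii).
exists (fmap F h \o eps Y) => x; rewrite /= nat -fmap_compE.
transitivity (fmap F f1 (eps X x)); first by apply: fmap_ext => z; apply: hE.
by rewrite f1E /= eK.
Qed.

End EquivalenceProjInj.

Section Morita.
Context (k : fieldType) (A B : falgType k).
Context (AB : Morita_equivalent A B).

Lemma Morita_embedding :
  (forall P : fgmod B, projective P ->
     exists (Q : fgmod B) (j : {linear P -> Q}),
       [/\ projective Q, injective_module Q & injective j]) ->
  exists (Q : fgmod A) (j : {linear mreg A -> Q}),
     [/\ projective Q, injective_module Q & injective j].
Proof.
have [F [G [FG GF]]] := AB => emb.
have [|Q [j [Qp Qi ji]]] := emb (F (mreg A)).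
  exact: equivalence_projective FG GF _ (@reg_projective _ _).
have [eta [etab _]] := FG.
exists (G Q), (fmap G j \o eta (mreg A)); split.
- exact: equivalence_projective GF FG _ Qp.
- exact: equivalence_injective_module GF FG _ Qi.
by apply: inj_comp (bij_inj (etab _)); apply: equivalence_injective GF FG _ _ _ ji.
Qed.

Lemma Morita_kernels :
  (forall (P P' : fgmod B) (f : {linear P -> P'}),
     projective P -> projective P' -> projective (mker f)) ->
  forall (P P' : fgmod A) (f : {linear P -> P'}),
     projective P -> projective P' -> projective (mker f).
Proof.
have [F [G [FG GF]]] := AB => kerp P P' f Pp P'p.
have FKp : projective (mker (fmap F f)).
  by apply: kerp; apply: (equivalence_projective FG GF).
have Fi := equivalence_injective FG GF (@ker_incl_inj _ _ _ _ f).
have FK := equivalence_kernel FG GF (@ker_incl_inj _ _ _ _ f) (ker_inclP f).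
have [c cE] : exists c : {linear mker (fmap F f) -> F (mker f)},
    forall x, fmap F (ker_incl f) (c x) = ker_incl (fmap F f) x.
  by apply: factor_injective => // x; apply/FK/ker_inclE.
have cb : bijective c.
  apply: bij_of_inj_surj => [x y cxy | y].
    by apply: (@ker_incl_inj _ _ _ _ (fmap F f)); rewrite -!cE cxy.
  have /(ker_inclP (fmap F f))[x xE] : fmap F f (fmap F (ker_incl f) y) = 0.
    by apply/FK; exists y.
  by exists x; apply: Fi; rewrite cE.
have [eta [etab _]] := FG.
have [e [eK Ke]] := linear_inverse (etab (mker f)).
apply: (projective_iso (f := e)); first by exists (eta (mker f)).
apply: (equivalence_projective GF FG).
exact: projective_iso cb FKp.
Qed.

End Morita.

(** * The endomorphism algebra of an additive generator *)

Section Dual.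
Context (k : fieldType) (E : falgType k) (V : vectType k).

(** A left E-module structure on a k-vector space, the input of the duality
between left and right modules. *)
Record left_action := LeftAction {
  act :> E -> 'End(V);
  act1 : forall v, act 1 v = v;
  actM : forall a b v, act (a * b) v = act a (act b v);
  actP : forall (c : k) a b v, act (c *: a + b) v = c *: act a v + act b v
}.

(** The action occurs only as a parameter, so that the right E-module structure
can be inferred from the type. *)
Definition dual (rho : left_action) : Type := 'Hom(V, k^o).
HB.instance Definition _ rho := GRing.Zmodule.on (dual rho).

Context (rho : left_action).

Lemma actD a b v : rho (a + b) v = rho a v + rho b v.
Proof. by rewrite -[a]scale1r actP !scale1r. Qed.
Lemma act0 v : rho 0 v = 0.
Proof. by apply: (addrI (rho 0 v)); rewrite -actD !addr0. Qed.
Lemma actZ c a v : rho (c *: a) v = c *: rho a v.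
Proof. by rewrite -[c *: a]addr0 actP act0 addr0. Qed.

Definition dual_scale (a : E^c) (x : dual rho) : dual rho :=
  ((x : 'Hom(V, k^o)) \o rho a)%VF.

Fact dual_scaleA a b x : dual_scale a (dual_scale b x) = dual_scale (a * b) x.
Proof.
by apply/lfunP => v; rewrite !comp_lfunE [in RHS](actM rho b a).
Qed.
Fact dual_scale1 : left_id 1 dual_scale.
Proof. by move=> x; apply/lfunP => v; rewrite comp_lfunE act1. Qed.
Fact dual_scaleDr : right_distributive dual_scale +%R.
Proof. by move=> a x y; apply/lfunP => v; rewrite !(comp_lfunE, add_lfunE). Qed.
Fact dual_scaleDl x : {morph dual_scale^~ x : a b / a + b}.
Proof.
by move=> a b; apply/lfunP => v; rewrite add_lfunE !comp_lfunE actD linearD.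
Qed.
HB.instance Definition _ :=
  GRing.Zmodule_isLmodule.Build E^c (dual rho)
    dual_scaleA dual_scale1 dual_scaleDr dual_scaleDl.

Fact dual_fg : finitely_generated (dual rho).
Proof.
apply: kvec_fg; pose b := vbasis {: 'Hom(V, k^o)}; exists (\dim {: 'Hom(V, k^o)}).
exists (fun i => b`_i : kvec (dual rho)) => x.
exists (fun i => coord b i x).
rewrite [LHS](coord_vbasis (memvf (x : 'Hom(V, k^o)))).
apply: eq_bigr => i _; apply/lfunP => v.
rewrite [RHS]comp_lfunE scale_lfunE actZ act1.
exact: (esym (linearZ _ _)).
Qed.
Definition mdual : fgmod E := FgMod dual_fg.

Lemma dual_scaleE (a : E^c) (x : mdual) v :
  (a *: x : 'Hom(V, k^o)) v = (x : 'Hom(V, k^o)) (rho a v).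
Proof. exact: comp_lfunE. Qed.
Lemma dual_addE (x y : mdual) v :
  (x + y : 'Hom(V, k^o)) v = (x : 'Hom(V, k^o)) v + (y : 'Hom(V, k^o)) v.
Proof. exact: add_lfunE. Qed.
Lemma dual_linE (a : E^c) (x y : mdual) v :
  (a *: x + y : 'Hom(V, k^o)) v =
    (x : 'Hom(V, k^o)) (rho a v) + (y : 'Hom(V, k^o)) v.
Proof. by rewrite dual_addE dual_scaleE. Qed.

(** Send a to the family of the functionals xi o a, where xi runs through the
coordinate functionals of V. *)
Lemma dual_separates : (forall a, (forall v, rho a v = 0) -> a = 0) ->
  exists n (j : {linear mreg E -> mpow n mdual}), injective j.
Proof.
move=> faithful; pose b := vbasis {: V}; exists (\dim {: V}).
pose x i : mdual := linfun (coord b i : V -> k^o).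
pose j : {linear mreg E -> mpow (\dim {: V}) mdual} :=
  dtuple (V := fun=> mdual : lmodType E^c) (fun i => elt (x i)).
exists j; apply: kernel_injective => a ja0; apply: faithful => v.
rewrite (coord_vbasis (memvf (rho a v))) big1 // => i _.
suff -> : coord b i (rho a v) = 0 by rewrite scale0r.
have := congr1 (fun z : mpow _ mdual => (z i : 'Hom(V, k^o)) v) ja0.
rewrite /j dtupleE ffunE zero_lfunE => <-.
by rewrite [RHS](dual_scaleE (a : E^c) (x i)) lfunE.
Qed.

End Dual.

Section KvecScale.
Context (k : fieldType) (A : falgType k).

Lemma scaler_kscale (X : lmodType A^c) (a : A^c) (c : k) (x : X) :
  a *: kscale c x = kscale c (a *: x).
Proof.
rewrite /kscale !scalerA; apply: (f_equal (fun b : A^c => b *: x)).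
rewrite -[LHS]/(_%:A * (a : A)) -[RHS]/((a : A) * _%:A).
by rewrite -scalerAl -scalerAr mul1r mulr1.
Qed.

Lemma extend_functional (X Y : fgmod A) (i : {linear X -> Y})
    (f : 'Hom(kvec X, k^o)) : injective i ->
  exists g : 'Hom(kvec Y, k^o), forall x, g (i x) = f x.
Proof.
move=> ii; have /eqP i0 := (lker_inj i).1 ii.
exists (f \o (linfun (klin i))^-1)%VF => x; rewrite comp_lfunE; congr (f _).
by rewrite -[RHS](lker0_lfunK i0 (x : kvec X)) lfunE.
Qed.

End KvecScale.

Section EndAlgebra.
Context (k : fieldType) (B E : falgType k) (M : fgmod B).
Context (phi : E -> {linear M -> M}).
Context (phi1 : phi 1 =1 id).
Context (phiM : forall u v, phi (u * v) =1 phi u \o phi v).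
Context (phiP : forall (c : k) u v x,
  phi (c *: u + v) x = kscale c (phi u x) + phi v x).
Context (phi_inj : forall u v, phi u =1 phi v -> u = v).
Context (phi_surj : forall f : {linear M -> M}, exists u, phi u =1 f).
Context (addM : forall X : fgmod B, retract X M).

Lemma phiD u v x : phi (u + v) x = phi u x + phi v x.
Proof. by rewrite -[u]scale1r phiP !scale1r kscale1. Qed.

Lemma phi_zero x : phi 0 x = 0.
Proof. by apply: (addrI (phi 0 x)); rewrite -phiD !addr0. Qed.

Lemma phi_sum (I : finType) (u : I -> E) x :
  phi (\sum_i u i) x = \sum_i phi (u i) x.
Proof.
by apply: (big_morph (fun u => phi u x)) => [a b|]; rewrite ?phiD ?phi_zero.
Qed.

Definition end_elt f : E := projT1 (cid (phi_surj f)).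
Lemma end_eltE f : phi (end_elt f) =1 f.
Proof. exact: projT2 (cid (phi_surj f)). Qed.

(** Writing P and P' as summands of E^m and E^n turns f into a matrix c over E,
hence into a B-linear map D : M^m -> M^n.  An element of ker f is a map from M
to ker D ([th]).  As ker D is a summand of M^r, composing with ker D -> M^r
gives r elements of E ([al_lin]), and composing back with M^r -> ker D
recovers the element of ker f ([z]). *)
Lemma end_kernel_retract (P P' : fgmod E) (f : {linear P -> P'}) :
  projective P -> projective P' -> retract (mker f) (mreg E).
Proof.
move=> /projective_reg_retract[m [i [p ip]]].
move=> /projective_reg_retract[n [i' [p' ip']]].
pose c l j : E := i' l (f (p j (1 : E^c^o))).
pose MM := fun _ : 'I_m => M : lmodType B^c.
pose D : {linear mpow m M -> mpow n M} :=
  dtuple (V := fun=> M : lmodType B^c)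
    (fun l => lsum (fun j => phi (c l j) \o dproj MM j)).
have DE x l : D x l = \sum_j phi (c l j) (x j) by rewrite /D dtupleE.
have cpE l j (e : E^c^o) : i' l (f (p j e)) = c l j * (e : E).
  by rewrite (elt1 (p j)) /= !linearZ.
have cE l x : i' l (f x) = \sum_j c l j * (i j x : E).
  by rewrite -{1}(ip x) !linear_sum; apply: eq_bigr => j _; apply: cpE.
have [r [a [b ab]]] := addM (mker D).
have /choice[th thE] (x : mker f) : exists t : {linear M -> mker D},
    forall y j, ker_incl D (t y) j = phi (i j (ker_incl f x)) y.
  pose h : {linear M -> mpow m M} :=
    dtuple (V := MM) (fun j => phi (i j (ker_incl f x))).
  have [|t tE] := factor_injective (f := h) (@ker_incl_inj _ _ _ _ D).
    move=> y; apply/ker_inclP/ffunP => l; rewrite DE ffunE.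
    transitivity (phi (\sum_j c l j * (i j (ker_incl f x) : E)) y).
      by rewrite phi_sum; apply: eq_bigr => j _; rewrite phiM /= /h dtupleE.
    by rewrite -cE ker_inclE linear0 phi_zero.
  by exists t => y j; rewrite tE /h dtupleE.
have th_lin e x y v : th (e *: x + y) v = th x (phi e v) + th y v.
  apply: (@ker_incl_inj _ _ _ _ D); apply/ffunP => j.
  by rewrite linearD ffunE !thE !linearP phiD phiM.
have al_lin t : linear (fun x => end_elt (a t \o th x) : E^c^o).
  move=> e x y; apply: phi_inj => v; rewrite end_eltE /= th_lin linearD.
  by rewrite [RHS]phiD phiM /= !end_eltE.
pose w t j := end_elt (dproj MM j \o ker_incl D \o b t).
pose y t := \sum_j p j (w t j : E^c^o).
have /choice[z zE] t : exists z : mker f, ker_incl f z = y t.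
  apply/ker_inclP; rewrite -[LHS]ip' big1 // => l _.
  have -> : i' l (f (y t)) = \sum_j c l j * w t j.
    by rewrite !linear_sum; apply: eq_bigr => j _; apply: cpE.
  rewrite (_ : \sum_j _ = 0) ?linear0 //; apply: phi_inj => v.
  rewrite phi_sum phi_zero.
  transitivity (D (ker_incl D (b t v)) l); last by rewrite ker_inclE ffunE.
  by rewrite DE; apply: eq_bigr => j _; rewrite phiM /= end_eltE /= dprojE.
apply: (retractI (a := fun t => lin (al_lin t)) (b := fun t => elt (z t))) => x.
apply: (@ker_incl_inj _ _ _ _ f); rewrite linear_sum -[RHS]ip.
pose al t := end_elt (a t \o th x).
transitivity (\sum_t \sum_j p j (w t j * al t : E^c^o)).
  apply: eq_bigr => t _; rewrite [LHS]linearZ zE /y /= scaler_sumr.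
  by apply: eq_bigr => j _; rewrite -linearZ.
rewrite exchange_big /=; apply: eq_bigr => j _; rewrite -linear_sum.
congr (p j _); apply: phi_inj => v; rewrite phi_sum -thE -(ab (th x v)).
rewrite linear_sum sum_ffunE; apply: eq_bigr => t _.
by rewrite phiM /= end_eltE /= dprojE end_eltE.
Qed.

Definition end_action_fun (e : E) : 'End(kvec M) := linfun (klin (phi e)).

Fact end_act1 v : end_action_fun 1 v = v.
Proof. by rewrite lfunE; apply: phi1. Qed.
Fact end_actM a b v :
  end_action_fun (a * b) v = end_action_fun a (end_action_fun b v).
Proof. by rewrite !lfunE; apply: phiM. Qed.
Fact end_actP (c : k) a b v : end_action_fun (c *: a + b) v =
  c *: end_action_fun a v + end_action_fun b v.
Proof. by rewrite !lfunE; apply: phiP. Qed.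
Definition end_action := LeftAction end_act1 end_actM end_actP.

Lemma end_actionE e v : end_action e v = phi e v.
Proof. exact: lfunE. Qed.

Let DM := mdual end_action.

Lemma end_embeds : exists n (j : {linear mreg E -> mpow n DM}), injective j.
Proof.
apply: dual_separates => e e0; apply: phi_inj => v.
by rewrite phi_zero -[RHS](e0 v); symmetry; apply: end_actionE.
Qed.


Fact lmul_act1 (v : B) : (linfun (1 \*o idfun) : 'End(B)) v = v.
Proof. by rewrite lfunE /= mul1r. Qed.
Fact lmul_actM (a b v : B) : (linfun ((a * b) \*o idfun) : 'End(B)) v =
  (linfun (a \*o idfun) : 'End(B)) ((linfun (b \*o idfun) : 'End(B)) v).
Proof. by rewrite !lfunE /= mulrA. Qed.
Fact lmul_actP (c : k) (a b v : B) :
  (linfun ((c *: a + b) \*o idfun) : 'End(B)) v =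
  c *: (linfun (a \*o idfun) : 'End(B)) v + (linfun (b \*o idfun) : 'End(B)) v.
Proof. by rewrite !lfunE /= mulrDl scalerAl. Qed.
Definition lmul_action := LeftAction lmul_act1 lmul_actM lmul_actP.
Lemma lmul_actionE b v : lmul_action b v = b * v.
Proof. exact: lfunE. Qed.

Let DB := mdual lmul_action.

(** By adjunction DM = Hom_B(M, DB), a functional x corresponding to the map
m |-> (u |-> x (m u)) ([til]); evaluation at 1 goes back.  A factorization of
the identity of DB through M^r thus gives one of the identity of DM through
Hom_B(M, M)^r = E^r. *)
Lemma end_dual_retract : retract DM (mreg E).
Proof.
have [r [a [b ab]]] := addM DB.
have orb_lin (m : M) : linear (fun b : B => ((b : B^c) *: m : kvec M)).
  by move=> c u v; rewrite scalerDl kvec_scaleAl.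
pose til (x : DM) (m : M) : DB :=
  ((x : 'Hom(kvec M, k^o)) \o linfun (lin (orb_lin m)))%VF.
have tilE x m (u : B) : (til x m : 'Hom(B, k^o)) u =
    (x : 'Hom(kvec M, k^o)) ((u : B^c) *: m).
  by rewrite comp_lfunE lfunE.
have til_lin x : linear (til x).
  move=> c m m'; apply/lfunP => u; rewrite dual_linE !tilE lmul_actionE.
  by rewrite scalerDr scalerA linearD.
have til_linr c x x' m : til (c *: x + x') m = til x (phi c m) + til x' m.
  apply/lfunP => u; rewrite dual_addE !tilE dual_linE.
  congr (_ + _); congr ((x : 'Hom(kvec M, k^o)) _).
  by rewrite [LHS]end_actionE linearZ.
have al_lin t : linear (fun x => end_elt (a t \o lin (til_lin x)) : E^c^o).
  move=> e x y; apply: phi_inj => m; rewrite end_eltE /= til_linr linearD.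
  by rewrite [RHS]phiD phiM /= !end_eltE.
have ev_lin t : linear (fun m : kvec M => (b t m : 'Hom(B, k^o)) 1 : k^o).
  move=> c m m'; rewrite kvec_scaleE /kscale.
  rewrite linearP dual_linE lmul_actionE mulr1 linearZ.
  by [].
pose et t : DM := linfun (lin (ev_lin t)).
have etE t m : (et t : 'Hom(kvec M, k^o)) m = (b t m : 'Hom(B, k^o)) 1.
  by rewrite lfunE.
apply: (retractI (a := fun t => lin (al_lin t)) (b := fun t => elt (et t))) => x.
apply/lfunP => m; transitivity ((til x m : 'Hom(B, k^o)) 1); last first.
  by rewrite tilE scale1r.
rewrite -[in RHS](ab (til x m)).
have ev_sum (V : vectType k) (I : finType) (g : I -> 'Hom(V, k^o)) v :
  (\sum_i g i) v = \sum_i g i v by rewrite sum_lfunE.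
rewrite [LHS]ev_sum [RHS]ev_sum; apply: eq_bigr => t _.
by rewrite [LHS]dual_scaleE etE end_actionE end_eltE.
Qed.

(** Factor the identity of B through M^r as (a_j), (q_j), and let u_j = a_j 1
and R_j m = (x |-> q_j(x) m) in E, so that m is the sum of the (R_j m) u_j:
M is a projective left E-module.  By E-linearity, f : X -> DM is determined by
the functionals x |-> f x (u_j), which extend to functionals psi_j of Y; the
extension of f is y |-> (m |-> sum of the psi_j (y (R_j m))). *)
Lemma end_dual_injective : injective_module DM.
Proof.
move=> X Y i f ii.
have [r [a [q aq]]] := addM (mreg B).
pose u j : M := a j (1 : B^c^o).
have uq (m : M) : \sum_j (q j (u j) : B^c) *: m = m.
  by rewrite -scaler_suml [X in X *: _](aq (1 : B^c^o)) scale1r.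
have ph_lin j : linear (fun x : kvec X => (f x : 'Hom(kvec M, k^o)) (u j) : k^o).
  move=> c x y; rewrite kvec_scaleE /kscale linearP dual_linE.
  rewrite -[c%:A]addr0 end_actionE phiP phi1 phi_zero addr0.
  by congr (_ + _); rewrite -[kscale c (u j)]/(c *: (u j : kvec M)) linearZ.
have /choice[psi psiE] j := extend_functional (linfun (lin (ph_lin j))) ii.
pose R j m : E := end_elt (elt m \o q j).
have RP j c (m m' : kvec M) : R j (c *: m + m') = c *: R j m + R j m'.
  apply: phi_inj => x; rewrite phiP !end_eltE /= scalerDr.
  by congr (_ + _); apply: scaler_kscale.
have RM j e m : R j (phi e m) = e * R j m.
  by apply: phi_inj => x; rewrite phiM /= !end_eltE /= linearZ.
have h_lin (y : Y) : linear (fun m : kvec M =>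
    \sum_j psi j ((R j m : E^c) *: y) : k^o).
  move=> c m m'; rewrite scaler_sumr -big_split; apply: eq_bigr => j _.
  by rewrite RP scalerDl kvec_scaleAl linearP.
pose h (y : Y) : DM := linfun (lin (h_lin y)).
have hE y m : (h y : 'Hom(kvec M, k^o)) m = \sum_j psi j ((R j m : E^c) *: y).
  by rewrite lfunE.
have hl : linear h.
  move=> e y y'; apply/lfunP => m; rewrite dual_linE end_actionE !hE -big_split.
  apply: eq_bigr => j _; rewrite RM scalerDr scalerA linearD.
  by [].
exists (lin hl) => x; apply/lfunP => m; rewrite /= hE -{2}(uq m).
rewrite linear_sum; apply: eq_bigr => j _.
rewrite -linearZ psiE lfunE /= linearZ [LHS]dual_scaleE end_actionE end_eltE.
by [].
Qed.

Lemma end_projective_embeds (P : fgmod E) : projective P ->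
  exists (Q : fgmod E) (j : {linear P -> Q}),
    [/\ projective Q, injective_module Q & injective j].
Proof.
move=> /projective_reg_retract[n [a [b ab]]].
have [m [j ji]] := end_embeds.
pose g : {linear P -> mpow n (mpow m DM)} :=
  dtuple (V := fun=> mpow m DM : lmodType E^c) (fun i => j \o a i).
exists (mpow n (mpow m DM)), g; split.
- do 2!apply: projective_pow.
  exact: projective_retract end_dual_retract (@reg_projective _ _).
- by do 2!apply: injective_pow; apply: end_dual_injective.
move=> x y gxy; rewrite -(ab x) -(ab y); apply: eq_bigr => i _; congr (b i _).
by apply: ji; have := congr1 (fun z : mpow n _ => z i) gxy; rewrite /g !dtupleE.
Qed.

End EndAlgebra.

Section FiniteType.
Context (k : fieldType) (B : falgType k).

Lemma retract_generator n (M : 'I_n -> fgmod B) : complete_indecomposables M ->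
  forall X : fgmod B, retract X (msum M).
Proof.
move=> [_ _ complete]; elim/fgmod_ind => [X X0|X Xi|X Y Z].
- apply: (@retractI _ _ void _ _
    (fun i => match i with end) (fun i => match i with end)).
  by move=> x; rewrite [RHS]X0; apply: X0.
- have [i [f /linear_inverse[g [fK _]]]] := complete X Xi.
  apply: (retract_trans (retract_split fK)).
  apply: (retract_split (a := dinj (fun i => M i : lmodType B^c) i)
    (b := dproj (fun i => M i : lmodType B^c) i)) => x.
  by rewrite dprojE dinj_same.
exact: retract_iso_prod.
Qed.
End FiniteType.

(** * Auslander algebras *)

Theorem theorem1p3 (k : closedFieldType) (A : falgType k) :
  Auslander_algebra A ->
  exists T : fgmod A, tilting T /\ hereditary_property T.
Proof.
move=> [B [n [M [E [complete [phi [phi1 phiM phiP phi_inj phi_surj]] AE]]]]].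
have addM := retract_generator complete.
have kernels : forall (P P' : fgmod E) (f : {linear P -> P'}),
    projective P -> projective P' -> projective (mker f).
  move=> P P' f Pp P'p; apply: (@projective_retract _ _ (mreg E)).
    exact: (end_kernel_retract (M := msum M)
      phiM phiP phi_inj phi_surj addM f Pp P'p).
  exact: reg_projective.
have embeds := end_projective_embeds (M := msum M)
  phi1 phiM phiP phi_inj phi_surj addM.
have [Q [j [Qp Qi ji]]] := Morita_embedding AE embeds.
exact: tilting_hereditary_of_embedding Qp Qi ji (Morita_kernels AE kernels).
Qed.
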